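(* Let $p^{(1)},p^{(2)}:E\to[0,1]$ and $V:E\to\mathbb{R}$ be measurable functions. Consider the following system for the zero-sum game, required to hold for all $x\in E$: \begin{align*} \text{(a)}\quad & V(x)=\max\{(1-p^{(2)}(x))\alpha\Pi V(x)+p^{(2)}(x)g(x),\ (1-p^{(2)}(x))f(x)+p^{(2)}(x)h(x)\},\\ \text{(b)}\quad & V(x)=\min\{(1-p^{(1)}(x))\alpha\Pi V(x)+p^{(1)}(x)f(x),\ (1-p^{(1)}(x))g(x)+p^{(1)}(x)h(x)\},\\ \text{(c)}\quad & p^{(1)}(x)>0\Rightarrow (1-p^{(2)}(x))\alpha\Pi V(x)+p^{(2)}(x)g(x)\le(1-p^{(2)}(x))f(x)+p^{(2)}(x)h(x),\\ \text{(d)}\quad & p^{(1)}(x)<1\Rightarrow (1-p^{(2)}(x))\alpha\Pi V(x)+p^{(2)}(x)g(x)\ge(1-p^{(2)}(x))f(x)+p^{(2)}(x)h(x),\\ \text{(e)}\quad & p^{(2)}(x)>0\Rightarrow (1-p^{(1)}(x))\alpha\Pi V(x)+p^{(1)}(x)f(x)\ge(1-p^{(1)}(x))g(x)+p^{(1)}(x)h(x),\\ \text{(f)}\quad & p^{(2)}(x)<1\Rightarrow (1-p^{(1)}(x))\alpha\Pi V(x)+p^{(1)}(x)f(x)\le(1-p^{(1)}(x))g(x)+p^{(1)}(x)h(x). \end{align*} (A) Suppose $(p^{(1)},p^{(2)})$ is a global Markovian randomized equilibrium with value $V$. Then these functions satisfy the system (a)--(f). (B) Suppose $p^{(1)},p^{(2)}$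 and $V$ satisfy (a)--(f) and that $\sup_{n\in\mathbb{N}_0}|V(\tilde X_n)|\in L^1$. Then $(p^{(1)},p^{(2)})$ is a global Markovian randomized equilibrium with value $V$.
   Context: Setting. $X=(X_n)_{n\in\mathbb{N}_0}$ is a homogeneous Markov process with (measurable) state space $E$ and Markov kernel $\Pi$; under $\mathbb{P}_x$ (expectation $\mathbb{E}_x$) it starts at $X_0=x\in E$. Write $\Pi u(x)=\int_E u(y)\,\Pi(x,dy)$. The discount factor $\alpha\in(0,1)$ is constant and $f,g,h:E\to\mathbb{R}$ are measurable. The probability space supports two sequences $(\xi^{(i)}_n)_{n\in\mathbb{N}_0}$, $i=1,2$, of iid uniform $(0,1)$ random variables, independent of $X$ and of each other. Killed process. $\tilde X$ is the process $X$ killed at each time step with probability $1-\alpha$ (independently of everything else): $\tilde X_n=X_n$ for $n\le T$ and $\tilde X_n=K$ for $n>T$, where $\mathbb{P}(T=k)=(1-\alpha)\alpha^k$, $k\in\mathbb{N}_0$, and $K$ is an absorbing cemetery state at which all functions take the value $0$. Standing integrability assumption. Under every $\mathbb{P}_x$: $\sup_{n}|f(\tilde X_n)|,\ \sup_{n}|g(\tilde X_n)|,\ \sup_{n}|h(\tilde X_n)|\in L^1$. Membership in $L^1$ is always meant under every $\mathbb{P}_x$, $x\in E$. Stopping times. $\mathcal{T}_i$ is the set of ($\mathbb{N}_0\cup\{\infty\}$-valued) stopping times with respect to the filtration $\sigma(X_0,\dots,X_n,\xi^{(i)}_0,\dots,\xi^{(i)}_n)$, $n\in\mathbb{N}_0$.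 For measurable $p^{(i)}:E\to[0,1]$, let $\tau^{p^{(i)}}=\inf\{n\in\mathbb{N}_0:\ p^{(i)}(X_n)\ge\xi^{(i)}_n\}$ ($\inf\emptyset=\infty$), the Markovian randomized stopping time of player $i$ identified with $p^{(i)}$. Zero-sum game. Player 1 chooses $\tau_1\in\mathcal{T}_1$ to maximize, and player 2 chooses $\tau_2\in\mathcal{T}_2$ to minimize, $$J_1(x;\tau_1,\tau_2)=\mathbb{E}_x\big[\alpha^{\tau_1}f(X_{\tau_1})\mathbb{I}_{\{\tau_1<\tau_2\}}+\alpha^{\tau_2}g(X_{\tau_2})\mathbb{I}_{\{\tau_2<\tau_1\}}+\alpha^{\tau_1}h(X_{\tau_1})\mathbb{I}_{\{\tau_1=\tau_2<\infty\}}\big].$$ $(p^{(1)},p^{(2)})$ is a global Markovian randomized equilibrium if for all $x\in E$: $\sup_{\tau_1\in\mathcal{T}_1}J_1(x;\tau_1,\tau^{p^{(2)}})=J_1(x;\tau^{p^{(1)}},\tau^{p^{(2)}})=\inf_{\tau_2\in\mathcal{T}_2}J_1(x;\tau^{p^{(1)}},\tau_2)$. Its value is $V(x)=J_1(x;\tau^{p^{(1)}},\tau^{p^{(2)}})$. *)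

(* Defs.v *)
From HB Require Import structures.
From mathcomp Require Import all_boot all_order all_algebra.
From mathcomp Require Import all_classical all_reals all_analysis.
Set Implicit Arguments.
Unset Strict Implicit.
Unset Printing Implicit Defensive.
Import Order.TTheory GRing.Theory Num.Theory.
Import numFieldNormedType.Exports.
Local Open Scope classical_set_scope.
Local Open Scope ring_scope.

(* sigma(Y_k : k in I). *)
Definition sigma_of d d' (Om : measurableType d) (S : measurableType d')
    (Y : nat -> {mfun Om >-> S}) (I : set nat) : set (set Om) :=
  <<s \bigcup_(k in I) preimage_set_system [set: Om] (Y k) measurable >>.

(* sigma(X_0, ..., X_n, xi_0, ..., xi_n). *)
Definition history d d' (R : realType) (Om : measurableType d)
    (E : measurableType d') (X : nat -> {mfun Om >-> E})
    (xi : nat -> {mfun Om >-> R}) (n : nat) : set (set Om) :=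
  <<s sigma_of X `I_n.+1 `|` sigma_of xi `I_n.+1 >>.

(* The finite subfamilies of an arbitrary index type are given by injections
   from an ordinal. *)
Definition mutual_independence d (R : realType) (Om : measurableType d)
    (P : probability Om R) (I : Type) (F : I -> set (set Om)) : Prop :=
  forall (n : nat) (j : 'I_n -> I) (A : 'I_n -> set Om),
    injective j -> (forall k, F (j k) (A k)) ->
    P (\bigcap_k A k) = (\prod_(k < n) P (A k))%E.

(* Under [P x], X starts in x (its initial law is the Dirac measure, which
   is meaningful even when singletons of E are not measurable) and has
   one-step transition kernel Pi given its own past. *)
Definition markov_process d d' (R : realType) (Om : measurableType d)
    (E : measurableType d') (P : E -> probability Om R)
    (Pi : R.-pker E ~> E) (X : nat -> {mfun Om >-> E}) : Prop :=
  forall x : E,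
    (forall B, measurable B -> distribution (P x) (X 0%N) B = \d_x B) /\
    (forall (n : nat) (A : set Om) (B : set E),
      sigma_of X `I_n.+1 A -> measurable B ->
      P x (A `&` X n.+1 @^-1` B) = (\int[P x]_(w in A) Pi (X n w) B)%E).

Definition uniform01 d (R : realType) (Om : measurableType d)
    (P : probability Om R) (Y : {mfun Om >-> R}) : Prop :=
  forall B, measurable B -> distribution P Y B = uniform_prob (@ltr01 R) B.

Inductive source := Process | Noise1 of nat | Noise2 of nat | Lifetime.

Definition source_sigma d d' (R : realType) (Om : measurableType d)
    (E : measurableType d') (X : nat -> {mfun Om >-> E})
    (xi1 xi2 : nat -> {mfun Om >-> R}) (T : {mfun Om >-> nat})
    (s : source) : set (set Om) :=
  match s with
  | Process => sigma_of X [set: nat]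
  | Noise1 n => preimage_set_system [set: Om] (xi1 n) measurable
  | Noise2 n => preimage_set_system [set: Om] (xi2 n) measurable
  | Lifetime => preimage_set_system [set: Om] T measurable
  end.

(* [None] is the cemetery state, at which all functions take the value 0. *)
Definition killed (Om E : Type) (X : nat -> Om -> E) (T : Om -> nat)
    (n : nat) (w : Om) : option E :=
  if (n <= T w)%N then Some (X n w) else None.

Definition at_killed (R : realType) (E : Type) (u : E -> R)
    (y : option E) : R := if y is Some e then u e else 0.

Definition sup_killed_L1 d d' (R : realType) (Om : measurableType d)
    (E : measurableType d') (P : E -> probability Om R)
    (X : nat -> {mfun Om >-> E}) (T : {mfun Om >-> nat}) (u : E -> R) : Prop :=
  forall x : E, (P x).-integrable [set: Om]
    (fun w => ereal_sup
       (range (fun n => `|at_killed u (killed X T n w)|%:E))).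

(* N_0 with infinity, [None] standing for infinity. *)
Definition time := option nat.

Definition time_lt (s t : time) : bool :=
  match s, t with
  | Some m, Some n => (m < n)%N
  | Some _, None => true
  | None, _ => false
  end.

(* The infimum of a set of dates, infinity if it is empty. *)
Definition first_time (A : pred nat) : time :=
  match pselect (exists n, A n) with
  | left ex => Some (ex_minn ex)
  | right _ => None
  end.

Definition stopping_time d d' (R : realType) (Om : measurableType d)
    (E : measurableType d') (X : nat -> {mfun Om >-> E})
    (xi : nat -> {mfun Om >-> R}) (tau : Om -> time) : Prop :=
  forall n, history X xi n [set w | exists2 m, (m <= n)%N & tau w = Some m].

Definition markov_time d d' (R : realType) (Om : measurableType d)
    (E : measurableType d') (X : nat -> {mfun Om >-> E})
    (xi : nat -> {mfun Om >-> R}) (p : E -> R) (w : Om) : time :=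
  first_time (fun n => xi n w <= p (X n w)).

(* alpha^t u(X_t), only ever used on {t < infinity}. *)
Definition discounted (R : realType) (Om E : Type) (X : nat -> Om -> E)
    (alpha : R) (u : E -> R) (t : time) (w : Om) : R :=
  if t is Some n then alpha ^+ n * u (X n w) else 0.

Definition J1 d d' (R : realType) (Om : measurableType d)
    (E : measurableType d') (P : E -> probability Om R)
    (X : nat -> {mfun Om >-> E}) (alpha : R) (f g h : E -> R)
    (x : E) (tau1 tau2 : Om -> time) : \bar R :=
  'E_(P x)[fun w =>
      discounted X alpha f (tau1 w) w * (time_lt (tau1 w) (tau2 w))%:R
    + discounted X alpha g (tau2 w) w * (time_lt (tau2 w) (tau1 w))%:R
    + discounted X alpha h (tau1 w) w
        * ((tau1 w == tau2 w) && (tau1 w != None))%:R].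

Definition global_equilibrium d d' (R : realType) (Om : measurableType d)
    (E : measurableType d') (P : E -> probability Om R)
    (X : nat -> {mfun Om >-> E}) (xi1 xi2 : nat -> {mfun Om >-> R})
    (alpha : R) (f g h p1 p2 : E -> R) : Prop :=
  let J := J1 P X alpha f g h in
  let tau1 := markov_time X xi1 p1 in
  let tau2 := markov_time X xi2 p2 in
  forall x : E,
    ereal_sup [set J x t1 tau2 | t1 in stopping_time X xi1] = J x tau1 tau2 /\
    J x tau1 tau2 = ereal_inf [set J x tau1 t2 | t2 in stopping_time X xi2].

Definition equilibrium_value d d' (R : realType) (Om : measurableType d)
    (E : measurableType d') (P : E -> probability Om R)
    (X : nat -> {mfun Om >-> E}) (xi1 xi2 : nat -> {mfun Om >-> R})
    (alpha : R) (f g h p1 p2 V : E -> R) : Prop :=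
  forall x : E, (V x)%:E =
    J1 P X alpha f g h x (markov_time X xi1 p1) (markov_time X xi2 p2).

(* Pi u(x); real-valued, and meaningful when u is Pi(x, .)-integrable. *)
Definition kernel_op d (R : realType) (E : measurableType d)
    (Pi : R.-pker E ~> E) (u : E -> R) (x : E) : R :=
  \int[Pi x]_y u y.

(* Payoff rates when the opponent stops with probability q x: for continuing
   ([u] is received if the opponent stops), and for stopping ([u] is received
   if the opponent continues, [h] otherwise). *)
Definition cont_val d (R : realType) (E : measurableType d)
    (Pi : R.-pker E ~> E) (alpha : R) (q u V : E -> R) (x : E) : R :=
  (1 - q x) * alpha * kernel_op Pi V x + q x * u x.

Definition stop_val (R : realType) (E : Type) (q u h : E -> R) (x : E) : R :=
  (1 - q x) * u x + q x * h x.

Definition equilibrium_system d (R : realType) (E : measurableType d)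
    (Pi : R.-pker E ~> E) (alpha : R) (f g h p1 p2 V : E -> R) : Prop :=
  forall x : E,
    let C1 := cont_val Pi alpha p2 g V x in
    let S1 := stop_val p2 f h x in
    let C2 := cont_val Pi alpha p1 f V x in
    let S2 := stop_val p1 g h x in
    (V x = Num.max C1 S1 /\ V x = Num.min C2 S2) /\
    [/\ 0 < p1 x -> C1 <= S1,
        p1 x < 1 -> C1 >= S1,
        0 < p2 x -> C2 >= S2
      & p2 x < 1 -> C2 <= S2].

(* Main.v *)
Require Import Defs.
From HB Require Import structures.
From mathcomp Require Import all_boot all_order all_algebra.
From mathcomp Require Import all_classical all_reals all_analysis.
From mathcomp Require Import measurable_realfun giry ring lra.
Import Order.TTheory GRing.Theory Num.Theory.
Import numFieldNormedType.Exports.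
Local Open Scope classical_set_scope.
Local Open Scope ring_scope.
Set Implicit Arguments.
Unset Strict Implicit.
Unset Printing Implicit Defensive.

(** Everything rests on one round of the game. Suppose that the game is still
    running at date n, that player 2 stops with probability q (X_n), and that
    after this round a reward u (X_(n+1)) is paid. The noise of player 2 at date
    n is independent of the history and of the decision of player 1, and given
    both, the next state has law Pi (X_n). Hence the round is worth, on average,
    [stop_val q f h (X_n)] where player 1 stops and [cont_val q g u (X_n)] where
    player 1 continues (lemma [one_step]); if player 1 randomizes as well, the
    two are mixed ([mixed_val], lemma [one_step_mixed]). Chaining the rounds
    expresses the gains of the first N rounds plus a discounted terminal reward
    ([backward_induction]).

    The assumption on the killed process makes the passage N to infinity
    possible. The factor alpha^n is the probability to survive until date n, so the
    conditional expectation of the supremum along the killed path given the path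
    of X is an integrable random variable ([envelope]) that dominates all the
    discounted rewards. It yields the integrability of payoffs, the convergence
    of the partial gains to them ([payoff_limit]), and the disappearance of the
    terminal reward ([discounted_mean_cvg0]).

    From the system to the equilibrium: by the complementarity conditions on p1, V is
    the mixture of its stopping and continuation rates, so that V is the payoff of
    the two Markovian times ([J1_eq_value]). By the maximum equation both rates are
    at most V, so that against the
    time of player 2 the accumulated gains plus discounted V decrease on average,
    whatever stopping time player 1 uses ([J1_le_value]). Player 2 is handled by
    exchanging the players and the signs ([J1_swap], [value_le_J1]).

    From the equilibrium to the system: consider the deviations that use another
    stopping probability, 0 or 1, in the first round only. If V could be
    used as reward after one round, the payoff of such a deviation would be one
    of the four rates in the system, and the equilibrium property would compare it
    with V; these inequalities together with V being a mixture of the rates are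
    equivalent to the system ([max_mixture], [min_mixture]). As V need not satisfy
    the assumption on the killed process, it is reached as the limit of the values
    of the games with finite horizon ([value_iter]). The limit is taken under
    Pi by dominated convergence, the dominating function being the limit of the
    corresponding values for |f|, |g| and |h| ([value_iter_kernel_limit]); this
    also shows that V is Pi(x, .)-integrable. *)

(** * Independence from a sub-sigma-algebra *)

Local Notation L1 P Z := (P.-integrable setT (EFin \o Z)).

Lemma norm_add_ge0 (R : realDomainType) (r : R) : 0 <= r + `|r|.
Proof. by have := ler_norm (- r); rewrite normrN; lra. Qed.

Section sub_sigma_algebra.
Context {d : measure_display} {R : realType} {Om : measurableType d}.
Variable P : probability Om R.

(** The sets A that satisfy the identity form a lambda-system, so Dynkin's theorem
    extends it from the pi-system G. With phi a version of the conditional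
    probability of D, this is how independence and the Markov property reach
    larger sigma-algebras. *)
Lemma cond_prob_pi_system (G : set (set Om)) (D : set Om) (phi : Om -> \bar R) :
  G `<=` measurable -> setI_closed G -> G setT -> measurable D ->
  measurable_fun setT phi -> (forall w, 0 <= phi w)%E ->
  (forall A, G A -> P (A `&` D) = \int[P]_(w in A) phi w)%E ->
  forall A, <<s G >> A -> P (A `&` D) = (\int[P]_(w in A) phi w)%E.
Proof.
move=> mG GI GT mD mphi phi0 H.
suff: <<s G >> `<=` [set A | measurable A /\
    P (A `&` D) = (\int[P]_(w in A) phi w)%E].
  by move=> S A /S[].
apply: lambda_system_subset => //; last first.
  by move=> A GA; split; [exact: mG|exact: H].
have fin A : measurable A -> (\int[P]_(w in A) phi w \is a fin_num)%E.
  move=> mA; rewrite ge0_fin_numE ?integral_ge0//.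
  apply: (@le_lt_trans _ _ (\int[P]_(w in setT) phi w)%E).
    exact: ge0_subset_integral.
  rewrite -H// (le_lt_trans (probability_le1 P _)) ?ltry//.
  exact: measurableI.
apply/dynkin_lambda_system; split => /=.
- by split => //; exact: H.
- move=> A [mA HA]; split; first exact: measurableC.
  have mAC := measurableC mA.
  have dA : A `&` ~` A = set0 by rewrite setICr.
  have E1 : (P (A `&` D) + P (~` A `&` D) =
      \int[P]_(w in A) phi w + \int[P]_(w in ~` A) phi w)%E.
    have -> : (P (A `&` D) + P (~` A `&` D) = P (setT `&` D))%E.
      rewrite -[in RHS](setUv A) setIUl measureU//; try exact: measurableI.
      by rewrite setIACA dA set0I.
    rewrite H// -[in LHS](setUv A) ge0_integral_setU//.
    - exact: measurable_funTS.
    - by apply/disj_setPS; rewrite dA.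
  rewrite -[LHS](addeK _ (fin _ mA)) -[RHS](addeK _ (fin _ mA)).
  by congr (_ - _)%E; rewrite addeC -{1}HA [LHS]E1 addeC.
- move=> F tF HF; have mF k : measurable (F k) by case: (HF k).
  split; first exact: bigcupT_measurable.
  rewrite setI_bigcupl ge0_integral_bigcup//.
  + rewrite measure_bigcup//; last 2 first.
    * by move=> k _; exact: measurableI.
    * by apply: trivIset_setIr.
    rewrite (eq_eseriesl (Q := xpredT)); last by move=> k; rewrite in_setT.
    by apply: eq_eseriesr => k _; case: (HF k).
  + exact: measurable_funTS.
Qed.

(** Independence makes the joint law of the outcome, seen through G only, and of Y
    a product measure, to which Tonelli's theorem applies. *)
Lemma integral_indep_pair {d'} {T' : measurableType d'} (G : set (set Om))
    (Y : Om -> T') (nu : probability T' R)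
    (Phi : g_sigma_algebraType G * T' -> \bar R) :
  G `<=` measurable -> measurable_fun setT Y ->
  (forall A B, <<s G >> A -> measurable B ->
    P (A `&` Y @^-1` B) = P A * nu B)%E ->
  measurable_fun setT Phi -> (forall z, 0 <= Phi z)%E ->
  (\int[P]_w Phi (w, Y w) = \int[P]_w \int[nu]_y Phi (w, y))%E.
Proof.
move=> mG mY indep mPhi Phi0.
pose OmG : measurableType _ := g_sigma_algebraType G.
have sG : <<s G >> `<=` @measurable _ Om.
  exact: smallest_sub (@sigma_algebra_measurable _ Om) mG.
have mid : measurable_fun setT (fun w : Om => w : OmG).
  by move=> _ A mA; rewrite setTI; exact: sG.
have mpair : measurable_fun setT (fun w : Om => (w : OmG, Y w)).
  exact: measurable_fun_pair.
pose i1 : {mfun Om >-> OmG} := HB.pack (fun w : Om => w : OmG)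
  (isMeasurableFun.Build _ _ _ _ _ mid).
pose i2 : {mfun Om >-> (OmG * T')%type} := HB.pack (fun w : Om => (w : OmG, Y w))
  (isMeasurableFun.Build _ _ _ _ _ mpair).
transitivity (\int[distribution P i2]_z Phi z)%E.
  by rewrite ge0_integral_pushforward.
transitivity (\int[distribution P i1 \x nu]_z Phi z)%E.
  apply: eq_measure_integral => A mA _; apply/esym.
  apply: product_measure_unique => //.
rewrite fubini_tonelli1// ge0_integral_pushforward//.
- exact: measurable_fun_fubini_tonelli_F.
- by move=> w _; exact: integral_ge0.
Qed.

(** The case of [integral_indep_pair] where Y is the indicator of C. *)
Lemma integral_indep_event (G : set (set Om)) (C : set Om)
    (Z : g_sigma_algebraType G -> \bar R) :
  G `<=` measurable -> measurable C ->
  (forall A, <<s G >> A -> P (A `&` C) = P A * P C)%E ->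
  measurable_fun setT Z -> (forall w, 0 <= Z w)%E ->
  (\int[P]_(w in C) Z w = P C * \int[P]_w Z w)%E.
Proof.
move=> mG mC indep mZ Z0.
have sG : <<s G >> `<=` @measurable _ Om.
  exact: smallest_sub (@sigma_algebra_measurable _ Om) mG.
have mZ' : measurable_fun [set: Om] (Z : Om -> _).
  by move=> mD B mB; rewrite setTI; apply: sG; rewrite -[X in _ X]setTI; exact: mZ.
pose Y (w : Om) := w \in C.
have YE : Y @^-1` [set true] = C.
  by apply/seteqP; split => w /= => [/set_mem|/mem_set].
have mY : measurable_fun setT Y.
  by apply: (measurable_fun_bool true); rewrite setTI YE.
pose i : {mfun Om >-> bool} := HB.pack Y (isMeasurableFun.Build _ _ _ _ _ mY).
have := @integral_indep_pair _ _ G Y (distribution P i)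
  (fun z => if z.2 then Z z.1 else 0%E) mG mY.
rewrite /= => H.
have -> : (\int[P]_(w in C) Z w = \int[P]_w (if Y w then Z w else 0))%E.
  by rewrite integral_mkcond; apply: eq_integral => w _; rewrite patchE.
rewrite H//; last 3 first.
- move=> A B sA mB; rewrite -[X in (_ * X)%E]/(P (Y @^-1` B)).
  have {mB} [/eqP->|/eqP->|/eqP->|/eqP->] := set_bool B.
  + by rewrite YE indep.
  + have -> : Y @^-1` [set false] = ~` C.
      rewrite -YE; apply/seteqP; split => w /=; first by move=> ->.
      by case: (Y w).
    rewrite probability_setC// muleBr ?fin_num_measure//; last exact: sG.
    have mA := sG _ sA.
    by rewrite mule1 -indep// -setDE measureD// (le_lt_trans (probability_le1 P _)) ?ltry.
  + by rewrite preimage_set0 setI0 measure0 mule0.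
  + by rewrite preimage_setT setIT probability_setT mule1.
- exact: (@measurable_fun_if_pair _ _ (g_sigma_algebraType G) _ Z (cst 0%E)).
- by case=> w b /=; case: b.
have E w : (\int[distribution P i]_y (if y then Z w else 0) = Z w * P C)%E.
  transitivity (\int[distribution P i]_y (Z w * (\1_[set true] y)%:E))%E.
    apply: eq_integral => -[] _; rewrite indicE.
      by rewrite mem_set// mule1.
    by rewrite memNset// mule0.
  rewrite ge0_integralZl//.
  by rewrite integral_indic// setIT -[X in (_ * X)%E]/(P (Y @^-1` _)) YE.
by under eq_integral do rewrite E muleC; rewrite ge0_integralZl.
Qed.

Lemma L1_measurable (Z : Om -> R) : L1 P Z -> measurable_fun setT Z.
Proof. by move=> /integrableP[/measurable_EFinP]. Qed.

Lemma L1D (Z1 Z2 : Om -> R) : L1 P Z1 -> L1 P Z2 -> L1 P (fun w => Z1 w + Z2 w).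
Proof.
move=> i1 i2; rewrite [X in P.-integrable _ X](_ : _ = (EFin \o Z1) \+ (EFin \o Z2))%E//.
exact: integrableD.
Qed.

Lemma L1B (Z1 Z2 : Om -> R) : L1 P Z1 -> L1 P Z2 -> L1 P (fun w => Z1 w - Z2 w).
Proof.
move=> i1 i2; rewrite [X in P.-integrable _ X](_ : _ = (EFin \o Z1) \- (EFin \o Z2))%E//.
exact: integrableB.
Qed.

Lemma L1Z (c : R) (Z : Om -> R) : L1 P Z -> L1 P (fun w => c * Z w).
Proof.
move=> i; rewrite [X in P.-integrable _ X](_ : _ = fun w => c%:E * (EFin \o Z) w)%E//.
exact: integrableZl.
Qed.

Lemma le_L1 (Z1 Z2 : Om -> R) : measurable_fun setT Z1 ->
  (forall w, `|Z1 w| <= `|Z2 w|) -> L1 P Z2 -> L1 P Z1.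
Proof.
move=> m1 le12; apply: le_integrable => //; first exact/measurable_EFinP.
by move=> w _; rewrite /= lee_fin.
Qed.

Lemma L1_norm (Z : Om -> R) : L1 P Z -> L1 P (fun w => `|Z w|).
Proof.
move=> iZ; apply: (le_L1 _ _ iZ) => [|w]; last by rewrite normr_id.
by apply: measurableT_comp => //; exact: L1_measurable.
Qed.

Lemma L1M01 (b Z : Om -> R) : measurable_fun setT b ->
  (forall w, 0 <= b w <= 1) -> L1 P Z -> L1 P (fun w => b w * Z w).
Proof.
move=> mb b01 iZ; apply: (le_L1 _ _ iZ) => [|w].
  by apply: measurable_funM => //; exact: L1_measurable.
have /andP[b0 b1] := b01 w.
by rewrite normrM ger0_norm// ler_piMl.
Qed.

Lemma uniform_prob_Nyitv (q : R) : 0 <= q <= 1 ->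
  uniform_prob (@ltr01 R) `]-oo, q] = q%:E.
Proof.
move=> /andP[q0 q1].
rewrite /uniform_prob integral_uniform_pdf.
have -> : `]-oo, q]%classic `&` `[0, 1]%classic = `[0, q]%classic.
  apply/seteqP; split => x /=; rewrite !in_itv/=; first by case=> -> /andP[->].
  by move=> /andP[x0 xq]; rewrite x0 xq (le_trans xq).
rewrite (eq_integral (fun=> 1%:E)); last first.
  move=> x; rewrite inE/= in_itv/= => /andP[x0 xq].
  by rewrite /uniform_pdf x0 (le_trans xq)// subr0 invr1.
rewrite integral_cst//= mul1e lebesgue_measure_itv/= lte_fin.
by case: ltgtP q0 => // [q0 _|<- _]; rewrite ?oppr0 ?adde0// sube0.
Qed.

Section freezing.
Variables (G : set (set Om)) (xi : {mfun Om >-> R}).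
Hypothesis mG : G `<=` measurable.
Hypothesis xi_unif : uniform01 P xi.
Hypothesis xi_indep : forall A B, <<s G >> A -> measurable B ->
  P (A `&` xi @^-1` B) = (P A * P (xi @^-1` B))%E.
Variable Q : g_sigma_algebraType G -> R.
Hypothesis mQ : measurable_fun setT Q.
Hypothesis Q01 : forall w, 0 <= Q w <= 1.

Let below (w : Om) : R := (xi w <= Q w)%R%:R.

Let freezing_ge0 (Z : g_sigma_algebraType G -> R) :
  measurable_fun setT Z -> (forall w, 0 <= Z w) ->
  (\int[P]_w (below w * Z w)%:E = \int[P]_w (Q w * Z w)%:E)%E.
Proof.
move=> mZ Z0.
have := @integral_indep_pair _ _ G xi (distribution P xi)
  (fun z => ((z.2 <= Q z.1)%R%:R * Z z.1)%:E) mG.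
rewrite /= => H; rewrite H//; last 2 first.
- apply/measurable_EFinP; apply: measurable_funM.
    apply: (measurableT_comp (f := fun b : bool => b%:R : R)) => //.
    apply: measurable_fun_ler => //; exact: measurableT_comp.
  exact: measurableT_comp.
- by move=> z; rewrite lee_fin mulr_ge0.
apply: eq_integral => w _.
under eq_integral do rewrite mulrC EFinM.
rewrite ge0_integralZl//; last 2 first.
- apply/measurable_EFinP.
  apply: (measurableT_comp (f := fun b : bool => b%:R : R)) => //.
  exact: measurable_fun_ler.
- by rewrite lee_fin.
rewrite [RHS]EFinM muleC; congr (_ * _)%E.
transitivity (\int[distribution P xi]_y (\1_(`]-oo, Q w]%classic) y)%:E)%E.
  by apply: eq_integral => y _; rewrite indicE mem_setE in_itv.
by rewrite integral_indic// setIT [LHS]xi_unif// uniform_prob_Nyitv.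
Qed.

(** Given G, the noise is still uniform while Q and Z are known, so the indicator of
    xi <= Q averages to Q. *)
Lemma freezing (Z : g_sigma_algebraType G -> R) :
  measurable_fun setT Z -> L1 P Z ->
  \int[P]_w (below w * Z w) = \int[P]_w (Q w * Z w).
Proof.
move=> mZ iZ.
have sG : <<s G >> `<=` @measurable _ Om.
  exact: smallest_sub (@sigma_algebra_measurable _ Om) mG.
have mOm (F : g_sigma_algebraType G -> R) :
    measurable_fun setT F -> measurable_fun [set: Om] (F : Om -> R).
  move=> mF mD B mB; rewrite setTI; apply: sG; rewrite -[X in _ X]setTI.
  exact: mF.
have mbelow : measurable_fun setT below.
  apply: (measurableT_comp (f := fun b : bool => b%:R : R)) => //.
  by apply: measurable_fun_ler => //; exact: mOm.
have below01 w : 0 <= below w <= 1.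
  by rewrite /below ler0n lern1 leq_b1.
have iN := L1_norm iZ.
have iD := L1D iZ iN.
have mD : measurable_fun setT (fun w : g_sigma_algebraType G => Z w + `|Z w|).
  by apply: measurable_funD => //; exact: measurableT_comp.
have mN : measurable_fun setT (fun w : g_sigma_algebraType G => `|Z w|).
  exact: measurableT_comp.
(* [integral_indep_pair] concerns nonnegative functions: Z + |Z| and |Z| are, and
   both are integrable. *)
have split (b : Om -> R) : measurable_fun [set: Om] b -> (forall w, 0 <= b w <= 1) ->
    \int[P]_w (b w * Z w) =
    \int[P]_w (b w * (Z w + `|Z w|)) - \int[P]_w (b w * `|Z w|).
  move=> mb b01; rewrite -RintegralB//; try exact: L1M01.
  by apply: eq_Rintegral => w _; ring.
rewrite !split//; last exact: mOm.
congr (_ - _); congr fine; apply: freezing_ge0 => // w.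
exact: norm_add_ge0.
Qed.

End freezing.

End sub_sigma_algebra.

(** * The path enriched by independent sources *)

(** The lifetime has number 0; the noises of date n have numbers 2n+1 for player 1
    and 2n+2 for player 2. Adding them in this order, the decision of player 1 at
    a date is known before the noise of player 2 at the same date is drawn. *)
Definition noise_source (k : nat) : source :=
  if k is j.+1 then if odd j then Noise2 j./2 else Noise1 j./2 else Lifetime.

Lemma noise_source_inj : injective noise_source.
Proof.
move=> [|j] [|k] //=; try by case: ifP.
have := odd_double_half j; have := odd_double_half k.
move=> Ek Ej; case: ifP => oj; case: ifP => ok // [h]; congr _.+1;
  by rewrite -[LHS]Ej -[RHS]Ek oj ok h.
Qed.

Lemma noise_source1 k : noise_source k.*2.+1 = Noise1 k.
Proof. by rewrite /= odd_double doubleK. Qed.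

Lemma noise_source2 k : noise_source k.*2.+2 = Noise2 k.
Proof. by rewrite /= odd_double /= uphalf_double. Qed.

Lemma sigma_algebra_pi_system (T : pointedType) (G : set (set T)) : sigma_algebra setT G ->
  G setT /\ setI_closed G.
Proof.
move=> sG; have <- := sigma_algebra_id sG; split.
  exact: (@measurableT _ (g_sigma_algebraType G)).
by move=> A B; exact: (@measurableI _ (g_sigma_algebraType G)).
Qed.

Section histories.
Context {d d' : measure_display} {R : realType}.
Context {Om : measurableType d} {E : measurableType d'}.
Variables (X : nat -> {mfun Om >-> E}) (xi1 xi2 : nat -> {mfun Om >-> R}).
Variable T : {mfun Om >-> nat}.

Local Notation F := (source_sigma X xi1 xi2 T).

(** The sigma-algebra of X_k, k in I, and of the first N noise sources. Adding the
    sources one by one provides at each stage a generating pi-system made of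
    intersections of a known event with an event of the new source. *)
Fixpoint info (I : set nat) (N : nat) : set (set Om) :=
  if N is M.+1 then
    <<s [set A `&` C | A in info I M & C in F (noise_source M)] >>
  else sigma_of X I.

Lemma info_sigma_algebra I N : sigma_algebra setT (info I N).
Proof. by case: N => [|N]; exact: smallest_sigma_algebra. Qed.

Lemma info_id I N : <<s info I N >> = info I N.
Proof. exact/sigma_algebra_id/info_sigma_algebra. Qed.

Lemma source_sigma_algebra s : sigma_algebra setT (F s).
Proof.
case: s => [|n|n|]; first exact: smallest_sigma_algebra.
- by apply: sigma_algebra_preimage; exact: sigma_algebra_measurable.
- by apply: sigma_algebra_preimage; exact: sigma_algebra_measurable.
- by apply: sigma_algebra_preimage; exact: sigma_algebra_measurable.
Qed.

Lemma preimage_system_measurable d1 (S : measurableType d1) (Y : {mfun Om >-> S}) :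
  preimage_set_system setT Y measurable `<=` @measurable _ Om.
Proof. by move=> _ [B mB <-]; exact: (measurable_funP Y). Qed.

Lemma sigma_of_measurable I : sigma_of X I `<=` measurable.
Proof.
apply: smallest_sub; first exact: sigma_algebra_measurable.
by move=> A [k _]; exact: preimage_system_measurable.
Qed.

Lemma source_measurable s : F s `<=` measurable.
Proof.
case: s => [|n|n|]; first exact: sigma_of_measurable.
- exact: preimage_system_measurable.
- exact: preimage_system_measurable.
- exact: preimage_system_measurable.
Qed.

Lemma info_measurable I N : info I N `<=` measurable.
Proof.
elim: N => [|N IH]; first exact: sigma_of_measurable.
apply: smallest_sub; first exact: sigma_algebra_measurable.
move=> _ [A hA [C hC <-]]; apply: measurableI; first exact: IH.
exact: source_measurable hC.
Qed.

Lemma info_step I N : info I N `<=` info I N.+1.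
Proof.
move=> A hA; apply: sub_gen_smallest; exists A => //.
have [FT _] := sigma_algebra_pi_system (source_sigma_algebra (noise_source N)).
by exists setT => //; rewrite setIT.
Qed.

Lemma info_le I M N : (M <= N)%N -> info I M `<=` info I N.
Proof.
elim: N => [|N IH]; first by rewrite leqn0 => /eqP->.
rewrite leq_eqVlt => /predU1P[->//|/IH H]; apply: subset_trans H _.
exact: info_step.
Qed.

Lemma info_subset I J N : I `<=` J -> info I N `<=` info J N.
Proof.
move=> IJ; elim: N => [|N IH].
  apply: smallest_sub; first exact: smallest_sigma_algebra.
  by move=> A [k Ik Ak]; apply: sub_gen_smallest; exists k => //; exact: IJ.
apply: smallest_sub; first exact: smallest_sigma_algebra.
move=> _ [A hA [C hC <-]]; apply: sub_gen_smallest.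
by exists A; [exact: IH|exists C].
Qed.

Lemma source_info I k N : (k < N)%N -> F (noise_source k) `<=` info I N.
Proof.
move=> kN; apply: (@subset_trans _ (info I k.+1)); last exact: info_le.
move=> C hC; apply: sub_gen_smallest.
have [iT _] := sigma_algebra_pi_system (info_sigma_algebra I k).
by exists setT => //; exists C => //; rewrite setTI.
Qed.

Lemma path_info I n N B : I n -> measurable B -> info I N (X n @^-1` B).
Proof.
move=> In mB; apply: (@info_le I 0) => //.
apply: sub_gen_smallest; exists n => //; exists B => //.
by rewrite setTI.
Qed.

Lemma measurable_path_info I n N : I n ->
  measurable_fun [set: g_sigma_algebraType (info I N)] (X n).
Proof.
move=> In mD B mB; rewrite setTI; apply: sub_gen_smallest.
exact: path_info.
Qed.

Lemma info_pi_measurable I N :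
  [set A `&` C | A in info I N & C in F (noise_source N)] `<=` measurable.
Proof.
move=> _ [A hA [C hC <-]].
by apply: measurableI; [exact: info_measurable hA|exact: source_measurable hC].
Qed.

Lemma info_pi_system I N :
  let G := [set A `&` C | A in info I N & C in F (noise_source N)] in
  G setT /\ setI_closed G.
Proof.
have [iT iI] := sigma_algebra_pi_system (info_sigma_algebra I N).
have [FT FI] := sigma_algebra_pi_system (source_sigma_algebra (noise_source N)).
split; first by exists setT => //; exists setT => //; rewrite setTI.
move=> _ _ [A hA [C hC <-]] [A' hA' [C' hC' <-]].
exists (A `&` A'); first exact: iI.
by exists (C `&` C'); [exact: FI|rewrite setIACA].
Qed.

Section law.
Variable P : probability Om R.
Hypothesis indep : mutual_independence P F.

(** Mutual independence is about events of single sources; the induction on k moves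
    the first k sources to the side of the path. For this to work the claim has to
    carry an arbitrary number m of sources not yet moved. *)
Lemma info_indep_tail k (A : set Om) m (C : nat -> set Om) :
  info setT k A -> (forall i, F (noise_source (k + i)) (C i)) ->
  P (A `&` \bigcap_(i < m) C i) = (P A * \prod_(i < m) P (C i))%E.
Proof.
elim: k A m C => [|k IH] A m C hA hC.
  pose j (i : 'I_m.+1) := if val i is i'.+1 then noise_source i' else Process.
  pose B (i : 'I_m.+1) := if val i is i'.+1 then C i' else A.
  have jinj : injective j.
    move=> [[|a] ha] [[|b] hb] //; rewrite /j /=.
    - by move=> _; exact/val_inj.
    - by case: b hb => [|b] hb //=; case: ifP.
    - by case: a ha => [|a] ha //=; case: ifP.
    - by move/noise_source_inj => ab; apply/val_inj; rewrite /= ab.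
  have hB i : F (j i) (B i).
    by case: i => [[|a] ha]; rewrite /j /B //=; exact: hC.
  have := indep jinj hB; rewrite big_ord_recl /= => <-.
  congr (P _); apply/seteqP; split => w.
    by move=> [Aw Cw] [[|i] hi] _; rewrite /B //=; exact: Cw.
  move=> Bw; split; first exact: (Bw ord0).
  move=> i /= im; have im' : (i.+1 < m.+1)%N by [].
  exact: (Bw (Ordinal im')).
pose c := (\prod_(i < m) P (C i))%E.
have c0 : (0 <= c)%E by apply: prode_ge0 => i _; exact: measure_ge0.
have mC i : measurable (C i) by apply: source_measurable (hC i).
have [GT GI] := info_pi_system setT k.
have := @cond_prob_pi_system _ _ _ P _ (\bigcap_(i < m) C i) (cst c)
  (@info_pi_measurable setT k) GI GT.
move=> H; rewrite H//; last 2 first.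
- exact: bigcap_measurableType.
- move=> _ [A0 hA0 [C0 hC0 <-]].
  rewrite integral_cst//; last first.
    by apply: measurableI; [exact: info_measurable hA0|exact: source_measurable hC0].
  pose C' i := if i is i'.+1 then C i' else C0.
  have hC' i : F (noise_source (k + i)) (C' i).
    by case: i => [|i] /=; rewrite ?addn0// addnS -addSn.
  have := IH A0 m.+1 C' hA0 hC'; rewrite big_ord_recl /= -/c => E1.
  have := IH A0 1%N C' hA0 hC'; rewrite big_ord1 /= => E2.
  have s1 : \bigcap_(i < 1) C' i = C0.
    apply/seteqP; split => w; first by move=> /(_ 0%N); apply.
    by move=> ? [|].
  have sm : \bigcap_(i < m.+1) C' i = C0 `&` \bigcap_(i < m) C i.
    apply/seteqP; split => w.
      move=> H'; split; first exact: (H' 0%N).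
      by move=> i /= im; exact: (H' i.+1).
    by move=> [? H'] [|i] //= im; exact: H'.
  by rewrite -setIA -sm E1 muleA -E2 s1 muleC.
rewrite integral_cst// 1?muleC//; exact: info_measurable hA.
Qed.

Lemma info_indep N (A C : set Om) : info setT N A -> F (noise_source N) C ->
  P (A `&` C) = (P A * P C)%E.
Proof.
move=> hA hC; have [FT FI] := sigma_algebra_pi_system
  (source_sigma_algebra (noise_source N)).
pose C' i := if i is 0%N then C else setT.
have := @info_indep_tail N A 1%N C' hA.
rewrite big_ord1 /= => <-.
- congr (P (A `&` _)); apply/seteqP; split => w /=.
    by move=> Cw [|].
  by move=> /(_ 0%N); apply.
- case=> [|i] /=; rewrite ?addn0//.
  by have [] := sigma_algebra_pi_system (source_sigma_algebra (noise_source (N + i.+1))).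
Qed.

Variable Pi : R.-pker E ~> E.
Hypothesis markov : forall (n : nat) (A : set Om) (B : set E),
  sigma_of X `I_n.+1 A -> measurable B ->
  P (A `&` X n.+1 @^-1` B) = (\int[P]_(w in A) Pi (X n w) B)%E.

(** Each noise source is independent of the whole path of X, the state of date n+1
    included, so the probability of an event of that source factors out of
    both sides of the Markov property. *)
Lemma markov_info N n (A : set Om) (B : set E) :
  info `I_n.+1 N A -> measurable B ->
  P (A `&` X n.+1 @^-1` B) = (\int[P]_(w in A) Pi (X n w) B)%E.
Proof.
elim: N A => [|N IH] A hA mB; first exact: markov.
have [GT GI] := info_pi_system `I_n.+1 N.
have mD : measurable (X n.+1 @^-1` B).
  by rewrite -[X in measurable X]setTI; exact: (measurable_funP (X n.+1)).
have mPi : measurable_fun setT (Pi ^~ B) by exact: measurable_kernel.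
apply: (cond_prob_pi_system (@info_pi_measurable `I_n.+1 N)) hA => //.
- exact: (measurableT_comp mPi (measurable_funP (X n))).
- move=> _ [A0 hA0 [C hC <-]].
  have hA0T : info setT N A0 by apply: info_subset hA0.
  have mA0 := info_measurable hA0; have mC := source_measurable hC.
  have hAD : info setT N (A0 `&` X n.+1 @^-1` B).
    have [_ iI] := sigma_algebra_pi_system (info_sigma_algebra setT N).
    by apply: iI => //; exact: path_info.
  rewrite setIAC (info_indep hAD hC) IH// setIC integral_mkcondr muleC.
  rewrite [RHS](integral_indep_event (G := info setT N))//.
  + by rewrite [in LHS]integral_mkcond.
  + exact: info_measurable.
  + by move=> A'; rewrite info_id => hA'; exact: info_indep hA' hC.
  + have mPX : measurable_fun [set: g_sigma_algebraType (info setT N)]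
        (fun w => Pi (X n w) B).
      by apply: (measurableT_comp mPi); exact: measurable_path_info.
    apply/(measurable_restrictT _ _).1; last exact: measurable_funTS.
    exact: sub_gen_smallest.
  + by move=> w; apply: erestrict_ge0.
Qed.

End law.
End histories.

(** * Integration against a mixture *)

Section mixtures.
Context {d d' : measure_display} {R : realType}.
Context {Om : measurableType d} {E : measurableType d'}.

Section giry_of_measure.
Variables (m : {measure set E -> \bar R}) (m1 : (m setT <= 1)%E).

Let as_subprobability : set E -> \bar R := m.

HB.instance Definition _ := Measure.on as_subprobability.
HB.instance Definition _ :=
  Measure_isSubProbability.Build _ _ _ as_subprobability m1.

Definition giry_of_measure : giry E R := as_subprobability.

End giry_of_measure.

Lemma ge0_integral_mrestr (mu : {measure set Om -> \bar R}) (A : set Om)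
    (mA : measurable A) (f : Om -> \bar R) :
  measurable_fun setT f -> (forall w, 0 <= f w)%E ->
  (\int[mrestr mu mA]_w f w = \int[mu]_(w in A) f w)%E.
Proof.
move=> mf f0.
have mAC := measurableC mA.
have H0 : mrestr mu mA (~` A) = 0%E by rewrite /mrestr /= setICl measure0.
rewrite (ge0_negligible_integral mAC _ _ _ H0)//.
rewrite setDE setCK setTI; apply: eq_measure_integral => B mB BA.
by rewrite -[LHS]/(mu (B `&` A)) setIidl.
Qed.

(** The restriction to A of the law of Y is the mixture of the kappa w, that is, a
    bind in the Giry monad, and [giry_int_bind] says how to integrate against it. *)
Lemma ge0_integral_mixture (P : probability Om R) (A : set Om) (Y : Om -> E)
    (kappa : Om -> {measure set E -> \bar R}) :
  measurable A -> measurable_fun setT Y ->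
  (forall B, measurable B -> measurable_fun setT (kappa ^~ B)) ->
  (forall w, kappa w setT <= 1)%E ->
  (forall B, measurable B ->
    P (A `&` Y @^-1` B) = \int[P]_(w in A) kappa w B)%E ->
  forall h : E -> \bar R, measurable_fun setT h -> (forall y, 0 <= h y)%E ->
  (\int[P]_(w in A) h (Y w) = \int[P]_(w in A) \int[kappa w]_y h y)%E.
Proof.
move=> mA mY mk k1 H h mh h0.
have PA1 : (mrestr P mA setT <= 1)%E.
  by rewrite /mrestr /= setTI probability_le1.
pose PA : giry Om R := HB.pack (mrestr P mA)
  (Measure_isSubProbability.Build _ _ _ (mrestr P mA) PA1).
pose kap w := giry_of_measure (k1 w).
have mkap : measurable_fun setT kap.
  exact: measurable_giry_codensity.
have := giry_int_bind PA mkap mh h0.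
rewrite /giry_int ge0_integral_mrestr//; last 2 first.
- exact: (@measurable_fun_integral_kernel _ _ _ _ _ kappa).
- by move=> w; exact: integral_ge0.
move=> <-.
rewrite -(ge0_integral_mrestr _ mA); last 2 first.
- exact: measurableT_comp.
- by [].
transitivity (\int[pushforward (mrestr P mA) Y]_y h y)%E.
  by rewrite ge0_integral_pushforward.
apply: eq_measure_integral => B mB _.
rewrite -[LHS]/(P (Y @^-1` B `&` A)) setIC H//.
rewrite -[RHS]/(\int[giry_map mkap PA]_m giry_ev m B)%E.
rewrite -[RHS]/(\int[pushforward PA kap]_m giry_ev m B)%E.
rewrite ge0_integral_pushforward//; last exact: measurable_giry_ev.
rewrite -[LHS](ge0_integral_mrestr P mA)//.
exact: mk.
Qed.

End mixtures.

(** * Markov step and randomization step *)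

Section steps.
Context {d d' : measure_display} {R : realType}.
Context {Om : measurableType d} {E : measurableType d'}.
Variables (P : E -> probability Om R) (Pi : R.-pker E ~> E).
Variables (X : nat -> {mfun Om >-> E}) (xi1 xi2 : nat -> {mfun Om >-> R}).
Variable T : {mfun Om >-> nat}.
Hypothesis X_markov : markov_process P Pi X.
Hypothesis indep : forall x, mutual_independence (P x) (source_sigma X xi1 xi2 T).

Local Notation info := (info X xi1 xi2 T).

(** The class in which the one-step computations take place: unlike the condition on
    the supremum along the killed path, it is clearly stable under [kernel_op]. *)
Definition path_L1 (u : E -> R) : Prop :=
  measurable_fun setT u /\ forall x n, L1 (P x) (fun w => u (X n w)).

Lemma measurable_path (u : E -> R) n :
  measurable_fun setT u -> measurable_fun setT (fun w => u (X n w)).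
Proof. by move=> mu; exact: (measurableT_comp mu (measurable_funP (X n))). Qed.

Lemma start_integral x (u : E -> \bar R) : measurable_fun setT u ->
  (forall y, 0 <= u y)%E -> (\int[P x]_w u (X 0%N w) = u x)%E.
Proof.
move=> mu u0.
transitivity (\int[distribution (P x) (X 0%N)]_y u y)%E.
  by rewrite ge0_integral_pushforward//; exact: measurable_funP.
transitivity (\int[\d_x]_y u y)%E.
  by apply: eq_measure_integral => B mB _; have [H _] := X_markov x; exact: H.
by rewrite integral_dirac// diracT mul1e.
Qed.

Lemma start_L1 x (u : E -> R) : measurable_fun setT u ->
  L1 (P x) (fun w => u (X 0%N w)).
Proof.
move=> mu; apply/integrableP; split.
  by apply/measurable_EFinP; exact: measurable_path.
rewrite (@start_integral x (fun y => `|(u y)%:E|)%E)//= ?ltry//.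
by apply/measurable_EFinP; exact: measurableT_comp.
Qed.

Lemma start_expectation x (u : E -> R) : measurable_fun setT u ->
  \int[P x]_w u (X 0%N w) = u x.
Proof.
move=> mu; have iu := start_L1 x mu.
transitivity (\int[P x]_w ((u (X 0%N w) + `|u (X 0%N w)|) - `|u (X 0%N w)|)).
  by apply: eq_Rintegral => w _; ring.
rewrite RintegralB//; last 2 first.
- by apply: L1D => //; exact: L1_norm.
- exact: L1_norm.
have ge0 (v : E -> R) : measurable_fun setT v -> (forall y, 0 <= v y) ->
    \int[P x]_w v (X 0%N w) = v x.
  move=> mv v0; rewrite /Rintegral (@start_integral x (EFin \o v))//.
    exact/measurable_EFinP.
rewrite (ge0 (fun y => u y + `|u y|)); last 2 first.
- by apply: measurable_funD => //; exact: measurableT_comp.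
- by move=> y; exact: norm_add_ge0.
rewrite (ge0 (fun y => `|u y|))//; last exact: measurableT_comp.
by rewrite addrK.
Qed.

Lemma ge0_markov_step x n N (A : set Om) (h : E -> \bar R) :
  info `I_n.+1 N A -> measurable_fun setT h -> (forall y, 0 <= h y)%E ->
  (\int[P x]_(w in A) h (X n.+1 w) = \int[P x]_(w in A) \int[Pi (X n w)]_y h y)%E.
Proof.
move=> hA mh h0.
apply: (ge0_integral_mixture (kappa := fun w => Pi (X n w))) => //.
- exact: info_measurable hA.
- move=> B mB; have mPi : measurable_fun [set: E] (Pi ^~ B) by exact: measurable_kernel.
  exact: (measurableT_comp mPi (measurable_funP (X n))).
- by move=> w; rewrite prob_kernel.
- by move=> B mB; have [_ H] := X_markov x; apply: (markov_info (indep x) H) hA mB.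
Qed.

Lemma path_L1_kernel (u : E -> R) : path_L1 u ->
  forall x, (Pi x).-integrable setT (EFin \o u).
Proof.
move=> [mu iu] x; apply/integrableP; split; first exact/measurable_EFinP.
have mh : measurable_fun [set: E] (fun y => `|(u y)%:E|)%E.
  by apply: measurableT_comp => //; exact/measurable_EFinP.
have := @ge0_markov_step x 0%N 0%N setT _ _ mh (fun=> abse_ge0 _).
rewrite (@start_integral x (fun y => \int[Pi y]_z `|(u z)%:E|)%E).
- move=> <-; last first.
    have [iT _] := sigma_algebra_pi_system (info_sigma_algebra X xi1 xi2 T `I_1 0).
    exact: iT.
  by have /integrableP[_] := iu x 1%N.
- apply: measurable_fun_integral_kernel => //.
  by move=> U mU; exact: measurable_kernel.
- by move=> y; exact: integral_ge0.
Qed.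

Lemma path_L1D (u v : E -> R) : path_L1 u -> path_L1 v ->
  path_L1 (fun y => u y + v y).
Proof.
move=> [mu iu] [mv iv]; split; first exact: measurable_funD.
by move=> x n; exact: L1D.
Qed.

Lemma path_L1B (u v : E -> R) : path_L1 u -> path_L1 v ->
  path_L1 (fun y => u y - v y).
Proof.
move=> [mu iu] [mv iv]; split; first exact: measurable_funB.
by move=> x n; exact: L1B.
Qed.

Lemma path_L1_norm (u : E -> R) : path_L1 u -> path_L1 (fun y => `|u y|).
Proof.
move=> [mu iu]; split; first exact: measurableT_comp.
by move=> x n; exact: L1_norm.
Qed.

Lemma path_L1Z (c : R) (u : E -> R) : path_L1 u -> path_L1 (fun y => c * u y).
Proof.
move=> [mu iu]; split; first exact: measurable_funM.
by move=> x n; exact: L1Z.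
Qed.

Lemma path_L1M01 (b u : E -> R) : measurable_fun setT b ->
  (forall y, 0 <= b y <= 1) -> path_L1 u -> path_L1 (fun y => b y * u y).
Proof.
move=> mb b01 [mu iu]; split; first exact: measurable_funM.
by move=> x n; apply: L1M01 => //; exact: measurable_path.
Qed.

Lemma ge0_kernel_op (u : E -> R) : path_L1 u -> (forall y, 0 <= u y) ->
  forall x, (\int[Pi x]_y (u y)%:E = (kernel_op Pi u x)%:E)%E.
Proof.
move=> gu u0 x; rewrite /kernel_op /Rintegral fineK//.
by apply: integrable_fin_num => //; exact: path_L1_kernel.
Qed.

Lemma kernel_opD (u v : E -> R) x : path_L1 u -> path_L1 v ->
  kernel_op Pi (fun y => u y + v y) x = kernel_op Pi u x + kernel_op Pi v x.
Proof.
by move=> gu gv; rewrite /kernel_op RintegralD//; exact: path_L1_kernel.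
Qed.

Lemma ge0_path_L1_kernel_op (u : E -> R) : path_L1 u -> (forall y, 0 <= u y) ->
  path_L1 (kernel_op Pi u).
Proof.
move=> gu u0; have [mu iu] := gu.
have m1 : measurable_fun setT (fun x => \int[Pi x]_y (u y)%:E)%E.
  apply: measurable_fun_integral_kernel => //.
  - by move=> U mU; exact: measurable_kernel.
  - exact/measurable_EFinP.
have mk : measurable_fun setT (kernel_op Pi u).
  apply/measurable_EFinP; rewrite [X in measurable_fun _ X](_ : _ =
    fun x => \int[Pi x]_y (u y)%:E)%E//.
  by apply/funext => x; rewrite ge0_kernel_op.
split=> // x n; apply/integrableP; split.
  by apply/measurable_EFinP; exact: measurable_path.
have /integrableP[_] := iu x n.+1.
have iT := (sigma_algebra_pi_system (info_sigma_algebra X xi1 xi2 T `I_n.+1 0)).1.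
have := @ge0_markov_step x n 0%N setT (EFin \o u) iT _ _.
move=> H; rewrite (eq_integral (fun w => (u (X n.+1 w))%:E)); last first.
  by move=> w _; rewrite gee0_abs//= lee_fin.
rewrite [X in (X < _)%E](H _ _); last 2 first.
- exact/measurable_EFinP.
- by move=> y; rewrite /= lee_fin.
rewrite [X in (X < _)%E -> _](eq_integral (fun w => `|(kernel_op Pi u (X n w))%:E|)%E)//.
move=> w _; rewrite ge0_kernel_op// gee0_abs//.
by rewrite lee_fin Rintegral_ge0.
Qed.

(** Reduces the measurability of [kernel_op] and the Markov step to nonnegative
    functions, for which they come from [ge0_markov_step]. *)
Lemma kernel_op_split (u : E -> R) : path_L1 u -> kernel_op Pi u =
  fun x => kernel_op Pi (fun y => u y + `|u y|) x - kernel_op Pi (fun y => `|u y|) x.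
Proof.
move=> gu; apply/funext => x; rewrite kernel_opD ?addrK//.
exact: path_L1_norm.
Qed.

Lemma path_L1_kernel_op (u : E -> R) : path_L1 u -> path_L1 (kernel_op Pi u).
Proof.
move=> gu; have gN := path_L1_norm gu; have gD := path_L1D gu gN.
rewrite kernel_op_split//; apply: path_L1B; apply: ge0_path_L1_kernel_op => //.
by move=> y; exact: norm_add_ge0.
Qed.

Lemma L1_indic x (A : set Om) (Z : Om -> R) : measurable A -> L1 (P x) Z ->
  L1 (P x) (fun w => \1_A w * Z w).
Proof.
move=> mA; apply: L1M01; first exact: measurable_indic.
by move=> w; rewrite indicE ler0n lern1 leq_b1.
Qed.

Lemma integral_indicM x (A : set Om) (Z : Om -> R) :
  (\int[P x]_w (\1_A w * Z w)%:E = \int[P x]_(w in A) (Z w)%:E)%E.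
Proof.
rewrite [RHS]integral_mkcond; apply: eq_integral => w _.
by rewrite patchE indicE; case: (w \in A); rewrite ?mul1r// mul0r.
Qed.

Lemma markov_step x n N (A : set Om) (u : E -> R) :
  info `I_n.+1 N A -> path_L1 u ->
  \int[P x]_w (\1_A w * u (X n.+1 w)) =
  \int[P x]_w (\1_A w * kernel_op Pi u (X n w)).
Proof.
move=> hA gu; have gN := path_L1_norm gu; have gD := path_L1D gu gN.
have mA : measurable A by exact: info_measurable hA.
have ge0 (v : E -> R) : path_L1 v -> (forall y, 0 <= v y) ->
    \int[P x]_w (\1_A w * v (X n.+1 w)) =
    \int[P x]_w (\1_A w * kernel_op Pi v (X n w)).
  move=> gv v0; have [mv _] := gv.
  congr fine; rewrite !integral_indicM.
  rewrite (@ge0_markov_step x n N A (EFin \o v))//; last exact/measurable_EFinP.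
  by apply: eq_integral => w _; rewrite ge0_kernel_op.
have gKN := path_L1_kernel_op gN; have gKD := path_L1_kernel_op gD.
transitivity (\int[P x]_w (\1_A w * (u (X n.+1 w) + `|u (X n.+1 w)|)) -
   \int[P x]_w (\1_A w * `|u (X n.+1 w)|)).
  rewrite -RintegralB//.
  - by apply: eq_Rintegral => w _; ring.
  - by apply: L1_indic => //; exact: gD.2.
  - by apply: L1_indic => //; exact: gN.2.
rewrite (ge0 _ gD) ?(ge0 _ gN)//; last by move=> y; exact: norm_add_ge0.
rewrite -RintegralB//.
- by apply: eq_Rintegral => w _; rewrite (kernel_op_split gu); ring.
- by apply: L1_indic => //; exact: gKD.2.
- by apply: L1_indic => //; exact: gKN.2.
Qed.

(** The event A may depend on the whole path, and on the noises with a smaller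
    number than xi: [info_indep] makes xi independent of it. *)
Lemma freeze_step x n k (xi : {mfun Om >-> R}) (A : set Om) (q u : E -> R) :
  uniform01 (P x) xi ->
  source_sigma X xi1 xi2 T (noise_source k) =
    preimage_set_system setT xi measurable ->
  info setT k A -> measurable_fun setT q -> (forall y, 0 <= q y <= 1) ->
  path_L1 u ->
  \int[P x]_w ((xi w <= q (X n w))%R%:R * (\1_A w * u (X n w))) =
  \int[P x]_w (q (X n w) * (\1_A w * u (X n w))).
Proof.
move=> uxi Fk hA mq q01 gu.
have mX := @measurable_path_info _ _ _ _ _ X xi1 xi2 T setT n k Logic.I.
apply: (@freezing _ _ _ (P x) (info setT k) xi _ _ _ (fun w => q (X n w)) _ _
  (fun w => \1_A w * u (X n w))) => //.
- exact: info_measurable.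
- move=> A' B; rewrite info_id => hA' mB.
  by apply: (info_indep (indep x) hA'); rewrite Fk; exists B; rewrite ?setTI.
- exact: measurableT_comp mq mX.
- apply: measurable_funM; last exact: measurableT_comp gu.1 mX.
  apply: measurable_indic; exact: sub_gen_smallest.
- by apply: L1_indic; [exact: info_measurable hA|exact: gu.2].
Qed.

End steps.

(** * Discounting as killing *)

Section killing.
Context {d d' : measure_display} {R : realType}.
Context {Om : measurableType d} {E : measurableType d'}.
Variable alpha : R.
Hypothesis alpha01 : 0 < alpha < 1.

(** The law of the lifetime. *)
Let weight (k : nat) : R := (1 - alpha) * alpha ^+ k.

Lemma weight_ge0 k : 0 <= weight k.
Proof.
have /andP[a0 a1] := alpha01.
by rewrite /weight mulr_ge0 ?subr_ge0 ?exprn_ge0// ltW.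
Qed.

(** The discount factor of date n is the probability of surviving until n; every
    bound on discounted rewards comes from this. *)
Lemma weight_tail n : (\sum_(n <= k <oo) (weight k)%:E = (alpha ^+ n)%:E)%E.
Proof.
have /andP[a0 a1] := alpha01.
apply/cvg_lim => //.
rewrite -(cvg_shiftn n).
have wE N : (\sum_(n <= k < N + n) (weight k)%:E = (alpha ^+ n - alpha ^+ N * alpha ^+ n)%:E)%E.
  rewrite sumEFin; congr EFin; elim: N => [|N IH].
    by rewrite add0n big_geq// expr0; ring.
  rewrite addSn big_nat_recr ?leq_addl//= IH /weight exprD exprS; ring.
rewrite [X in X x @[x --> \oo]](_ : _ =
    EFin \o (fun N => alpha ^+ n - alpha ^+ N * alpha ^+ n)); last first.
  by apply/funext => N /=; rewrite wE.
apply: cvg_EFin; first by apply: nearW.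
rewrite -[X in _ --> X]subr0 -[X in _ --> _ - X](mul0r (alpha ^+ n)).
apply: cvgB; first exact: cvg_cst.
apply: cvgMl; apply: cvg_expr.
by rewrite ger0_norm// ltW.
Qed.

Lemma discount_le_tail (m : nat -> \bar R) (a : \bar R) n :
  (0 <= a)%E -> (forall k, (n <= k)%N -> a <= m k)%E ->
  ((alpha ^+ n)%:E * a <= \sum_(n <= k <oo) (weight k)%:E * m k)%E.
Proof.
move=> a0 am.
have -> : ((alpha ^+ n)%:E * a = \sum_(n <= k <oo) (weight k)%:E * a)%E.
  rewrite -weight_tail; case: a a0 {am} => [r r0| _|//].
    under [RHS]eq_eseriesr do rewrite muleC.
    by rewrite nneseriesZl 1?muleC// => k _; rewrite lee_fin weight_ge0.
  have w0 k : (0 < weight k)%R.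
    by have /andP[? ?] := alpha01; rewrite mulr_gt0 ?subr_gt0 ?exprn_gt0.
  rewrite weight_tail gt0_muley ?lte_fin ?exprn_gt0//; last by case/andP: alpha01.
  apply/esym/eqP; rewrite -leye_eq.
  apply: le_trans (nneseries_lim_ge n.+1 _) => [|k _ _]; last first.
    by rewrite mule_ge0// lee_fin weight_ge0.
  by rewrite big_nat1 gt0_muley// lte_fin.
rewrite eseries_cond [leRHS]eseries_cond; apply: lee_nneseries => [k _ _|k /= nk].
  by rewrite mule_ge0// lee_fin weight_ge0.
by rewrite lee_wpmul2l ?lee_fin ?weight_ge0// am.
Qed.

Lemma discount_le_series (m : nat -> \bar R) (a : \bar R) n :
  (0 <= a)%E -> (forall k, 0 <= m k)%E -> (forall k, (n <= k)%N -> a <= m k)%E ->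
  ((alpha ^+ n)%:E * a <= \sum_(0 <= k <oo) (weight k)%:E * m k)%E.
Proof.
move=> a0 m0 am; apply: le_trans (discount_le_tail a0 am) _.
rewrite eseries_cond [leRHS]eseries_cond.
apply: subset_lee_nneseries => // k _.
by rewrite mule_ge0// lee_fin weight_ge0.
Qed.

Variables (P : E -> probability Om R) (X : nat -> {mfun Om >-> E}).
Variables (xi1 xi2 : nat -> {mfun Om >-> R}) (T : {mfun Om >-> nat}).
Hypothesis T_geom : forall x k,
  P x [set w | T w = k] = ((1 - alpha) * alpha ^+ k)%:E.
Hypothesis indep : forall x, mutual_independence (P x) (source_sigma X xi1 xi2 T).

Variable u : E -> R.
Hypothesis mu : measurable_fun setT u.
Hypothesis u_L1 : sup_killed_L1 P X T u.

Fixpoint running_max (k : nat) (w : Om) : R :=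
  if k is j.+1 then Num.max (running_max j w) `|u (X j.+1 w)| else `|u (X 0%N w)|.

Lemma running_max_ge j k w : (j <= k)%N -> `|u (X j w)| <= running_max k w.
Proof.
elim: k => [|k IH]; first by rewrite leqn0 => /eqP->.
by rewrite leq_eqVlt /= le_max => /predU1P[->|/IH->//]; rewrite lexx orbT.
Qed.

Lemma running_max_ge0 k w : 0 <= running_max k w.
Proof. exact: le_trans (running_max_ge w (leq0n k)). Qed.

Lemma running_max_le k w : ((running_max k w)%:E <=
  ereal_sup [set `|u (X j w)|%:E | j in `I_k.+1])%E.
Proof.
elim: k => [|k IH] /=; first by apply: ereal_sup_ubound; exists 0%N.
rewrite EFin_max ge_max; apply/andP; split.
  apply: le_trans IH _; apply: le_ereal_sup => _ [j jk <-].
  by exists j => //=; apply: ltn_trans jk _.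
by apply: ereal_sup_ubound; exists k.+1 => /=.
Qed.

Lemma measurable_running_max_info N k :
  measurable_fun [set: g_sigma_algebraType (info X xi1 xi2 T setT N)] (running_max k).
Proof.
have mX j : measurable_fun [set: g_sigma_algebraType (info X xi1 xi2 T setT N)]
    (fun w => `|u (X j w)|).
  apply: measurableT_comp => //; apply: (measurableT_comp mu).
  exact: measurable_path_info.
by elim: k => [|k IH] //=; exact: measurable_maxr.
Qed.

Lemma measurable_running_max k : measurable_fun setT (running_max k).
Proof.
have mX j : measurable_fun setT (fun w => `|u (X j w)|).
  by apply: measurableT_comp (measurable_path _ _ mu).
by elim: k => [|k IH] //=; exact: measurable_maxr.
Qed.

(** The conditional expectation, given the path of X, of the supremum of |u| along
    the killed path: given a lifetime k, that supremum is [running_max k]. *)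
Definition envelope (w : Om) : \bar R :=
  (\sum_(0 <= k <oo) (weight k)%:E * (running_max k w)%:E)%E.

Lemma envelope_ge n w : (`|alpha ^+ n * u (X n w)|%:E <= envelope w)%E.
Proof.
have /andP[a0 a1] := alpha01.
have an0 : 0 <= alpha ^+ n by rewrite exprn_ge0// ltW.
rewrite normrM (ger0_norm an0) EFinM.
apply: discount_le_series; rewrite ?lee_fin//.
  by move=> k; rewrite lee_fin running_max_ge0.
by move=> k nk; rewrite lee_fin running_max_ge.
Qed.

Let mean_max x k := (\int[P x]_w (running_max k w)%:E)%E.

(** The lifetime, which is source number 0, is independent of the path. *)
Lemma killed_max_integral x k :
  (\int[P x]_(w in [set w | T w = k]) (running_max k w)%:E =
   (weight k)%:E * mean_max x k)%E.
Proof.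
have mT : measurable [set w | T w = k].
  have -> : [set w | T w = k] = T @^-1` [set k] by [].
  by rewrite -[X in measurable X]setTI; exact: (measurable_funP T).
rewrite -(T_geom x k).
rewrite (integral_indep_event (G := info X xi1 xi2 T setT 0)
  (Z := EFin \o running_max k))//.
- exact: info_measurable.
- move=> A; rewrite info_id => hA; apply: (info_indep (indep x) hA).
  by exists [set k] => //; rewrite setTI.
- by apply/measurable_EFinP; exact: measurable_running_max_info.
- by move=> w; rewrite /= lee_fin running_max_ge0.
Qed.

(** Splitting the expectation of the supremum along the killed path according to the
    lifetime gives a bound for this series, which is the expectation of
    [envelope]. *)
Lemma mean_max_summable x :
  (\sum_(0 <= k <oo) (weight k)%:E * mean_max x k < +oo)%E.
Proof.
have iu := u_L1 x; set S := (fun w => ereal_sup _) in iu.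
have S0 w : (0 <= S w)%E.
  apply: (@le_trans _ _ `|at_killed u (killed X T 0%N w)|%:E) => //.
  by apply: ereal_sup_ubound; exists 0%N.
have mS : measurable_fun setT S by have /integrableP[] := iu.
have FT : \bigcup_k [set w | T w = k] = setT.
  by apply/seteqP; split => // w _; exists (T w).
have mT k : measurable [set w | T w = k].
  have -> : [set w | T w = k] = T @^-1` [set k] by [].
  by rewrite -[X in measurable X]setTI; exact: (measurable_funP T).
have : (\int[P x]_w S w < +oo)%E.
  have /integrableP[_] := iu; congr (_ < _)%E; apply: eq_integral => w _.
  by rewrite gee0_abs.
apply: le_lt_trans; rewrite -FT ge0_integral_bigcup ?FT//; last first.
  by move=> i j _ _ [w [/= <- <-]].
apply: lee_nneseries => [k _ _|k _].
  by rewrite mule_ge0// ?lee_fin ?weight_ge0// integral_ge0// => w _; rewrite lee_fin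
    running_max_ge0.
rewrite -killed_max_integral; apply: ge0_le_integral => //.
- by move=> w _; rewrite lee_fin running_max_ge0.
- by apply/measurable_EFinP; apply: measurable_funTS; exact: measurable_running_max.
- exact: measurable_funTS.
move=> w /= Twk; apply: le_trans (running_max_le k w) _.
apply: le_ereal_sup => _ [j /= jk <-]; exists j => //.
by rewrite /killed Twk -ltnS jk.
Qed.

Lemma measurable_envelope : measurable_fun setT envelope.
Proof.
apply: ge0_emeasurable_sum => [k w _ _|k _].
  by rewrite mule_ge0// ?lee_fin ?weight_ge0// running_max_ge0.
by apply: measurable_funeM; apply/measurable_EFinP; exact: measurable_running_max.
Qed.

Lemma envelope_ge0 w : (0 <= envelope w)%E.
Proof.
apply: nneseries_ge0 => k _ _.
by rewrite mule_ge0// ?lee_fin ?weight_ge0// running_max_ge0.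
Qed.

Lemma integrable_envelope x : (P x).-integrable setT envelope.
Proof.
apply/integrableP; split; first exact: measurable_envelope.
under eq_integral do rewrite gee0_abs ?envelope_ge0//.
rewrite integral_nneseries//; last 2 first.
- by move=> k; apply: measurable_funeM; apply/measurable_EFinP; exact: measurable_running_max.
- by move=> k w _; rewrite mule_ge0// ?lee_fin ?weight_ge0// running_max_ge0.
apply: le_lt_trans (mean_max_summable x).
apply: lee_nneseries => [k _ _|k _].
  apply: integral_ge0 => w _.
  by rewrite mule_ge0// ?lee_fin ?weight_ge0// running_max_ge0.
rewrite ge0_integralZl//.
- by apply/measurable_EFinP; exact: measurable_running_max.
- by move=> w _; rewrite lee_fin running_max_ge0.
- by rewrite lee_fin weight_ge0.
Qed.

Lemma sup_killed_path_L1 : path_L1 P X u.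
Proof.
have /andP[a0 a1] := alpha01.
split=> // x n.
suff i : L1 (P x) (fun w => alpha ^+ n * u (X n w)).
  have := L1Z (alpha ^+ n)^-1 i; congr integrable; apply/funext => w /=.
  by rewrite mulrA mulVf ?mul1r// expf_neq0// gt_eqF.
apply: le_integrable (integrable_envelope x) => //.
  by apply/measurable_EFinP; apply: measurable_funM => //; exact: measurable_path mu.
by move=> w _ /=; rewrite (gee0_abs (envelope_ge0 _)); exact: envelope_ge.
Qed.

(** The discounted mean at date n is at most the n-th tail of the convergent series
    of [mean_max_summable]. *)
Lemma discounted_mean_cvg0 x :
  alpha ^+ n * \int[P x]_w `|u (X n w)| @[n --> \oo] --> 0.
Proof.
have gu := path_L1_norm sup_killed_path_L1.
have bound n : ((alpha ^+ n * \int[P x]_w `|u (X n w)|)%:E <=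
    \sum_(n <= k <oo) (weight k)%:E * mean_max x k)%E.
  rewrite EFinM; apply: discount_le_tail => //.
    by rewrite lee_fin Rintegral_ge0.
  move=> k nk; rewrite /Rintegral fineK; last first.
    by apply: integrable_fin_num => //; exact: gu.2.
  apply: ge0_le_integral => //.
  - by have /integrableP[] := gu.2 x n.
  - by apply/measurable_EFinP; exact: measurable_running_max.
  - by move=> w _; rewrite lee_fin running_max_ge.
have m0 k : (0 <= (weight k)%:E * mean_max x k)%E.
  rewrite mule_ge0 ?lee_fin ?weight_ge0// integral_ge0// => w _.
  by rewrite lee_fin running_max_ge0.
have tail := nneseries_tail_cvg (mean_max_summable x) (fun k _ => m0 k).
have : ((alpha ^+ n * \int[P x]_w `|u (X n w)|)%:E @[n --> \oo] --> 0%:E)%E.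
  apply: (squeeze_cvge _ (cvg_cst 0%E) tail); apply: nearW => n.
  have /andP[a0 a1] := alpha01.
  rewrite bound andbT lee_fin mulr_ge0 ?Rintegral_ge0// exprn_ge0//.
  exact: ltW.
by move/fine_cvg.
Qed.

End killing.

(** * Random times *)

Definition not_before (t : time) (n : nat) : bool :=
  if t is Some m then (n <= m)%N else true.

Lemma not_beforeS t n : not_before t n.+1 -> not_before t n.
Proof. by case: t => //= m; exact: ltnW. Qed.

Lemma time_eqE t n : (t == Some n) = not_before t n && ~~ not_before t n.+1.
Proof.
case: t => [m|//] /=; rewrite -leqNgt andbC -eqn_leq.
by apply/eqP/eqP => [[]|->].
Qed.

Lemma not_before_first_time (A : pred nat) n :
  not_before (first_time A) n <-> forall m, (m < n)%N -> ~~ A m.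
Proof.
rewrite /first_time; case: pselect => [ex|nex] /=.
  case: ex_minnP => m Am mmin; split => [nm k kn|H].
    by apply/negP => /mmin mk; have := leq_trans kn (leq_trans nm mk); rewrite ltnn.
  by rewrite leqNgt; apply/negP => /H; rewrite Am.
by split => // _ m _; apply/negP => Am; apply: nex; exists m.
Qed.

Lemma first_time_before (A : pred nat) n :
  ~~ not_before (first_time A) n.+1 = ~~ not_before (first_time A) n || A n.
Proof.
have H k := not_before_first_time A k.
case: (boolP (not_before (first_time A) n)) => [/H Hn|] /=; last first.
  by apply: contraNT; rewrite negbK; exact: not_beforeS.
apply/idP/idP => [|An]; last by apply/negP => /H/(_ n (leqnn _)); rewrite An.
apply: contraR => nAn; apply/H => m; rewrite ltnS leq_eqVlt.
by case/predU1P => [->|/Hn].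
Qed.

Section stopping_times.
Context {d d' : measure_display} {R : realType}.
Context {Om : measurableType d} {E : measurableType d'}.
Variables (X : nat -> {mfun Om >-> E}).

(** Date-dependent stopping probabilities are needed for the strategies that deviate
    in the first round only, which are no [markov_time]. *)
Definition inhomogeneous_time (xi : nat -> {mfun Om >-> R}) (q : nat -> E -> R)
  (w : Om) : time := first_time (fun n => xi n w <= q n (X n w)).

Lemma not_before_set (tau : Om -> time) n :
  [set w | exists2 m, (m <= n)%N & tau w = Some m] =
  ~` [set w | not_before (tau w) n.+1].
Proof.
apply/seteqP; split => w /=; first by move=> [m mn ->] /=; rewrite ltnNge mn.
by case: (tau w) => [m|//] /= /negP; rewrite -leqNgt => mn; exists m.
Qed.

Lemma stopping_inhomogeneous_time (xi : nat -> {mfun Om >-> R}) (q : nat -> E -> R) :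
  (forall n, measurable_fun setT (q n)) ->
  stopping_time X xi (inhomogeneous_time xi q).
Proof.
move=> mq n.
pose G := sigma_of X `I_n.+1 `|` sigma_of xi `I_n.+1.
suff : forall k, (k <= n)%N -> measurable
    [set w : g_sigma_algebraType G | not_before (inhomogeneous_time xi q w) k.+1].
  move=> H; rewrite not_before_set.
  exact: (@measurableC _ (g_sigma_algebraType G) _ (H n (leqnn n))).
have mX k : (k <= n)%N -> measurable_fun [set: g_sigma_algebraType G] (X k).
  move=> kn _ B mB; rewrite setTI; apply: sub_gen_smallest; left.
  by apply: sub_gen_smallest; exists k => //; exists B => //; rewrite setTI.
have mxi k : (k <= n)%N -> measurable_fun [set: g_sigma_algebraType G] (xi k).
  move=> kn _ B mB; rewrite setTI; apply: sub_gen_smallest; right.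
  by apply: sub_gen_smallest; exists k => //; exists B => //; rewrite setTI.
have ms k : (k <= n)%N ->
    measurable [set w : g_sigma_algebraType G | xi k w <= q k (X k w)].
  move=> kn.
  have : measurable_fun [set: g_sigma_algebraType G] (fun w => xi k w <= q k (X k w)).
    apply: measurable_fun_ler; first exact: mxi.
    by apply: (measurableT_comp (mq k)); exact: mX.
  by move=> /(_ measurableT [set true] I); rewrite setTI.
have step k : [set w : g_sigma_algebraType G | not_before (inhomogeneous_time xi q w) k.+1] =
   [set w : g_sigma_algebraType G | not_before (inhomogeneous_time xi q w) k] `&`
   ~` [set w : g_sigma_algebraType G | xi k w <= q k (X k w)].
  apply/seteqP; split => w /=.
    move=> H; have := first_time_before (fun n => xi n w <= q n (X n w)) k.
    rewrite -/(inhomogeneous_time xi q w) H /= => /esym/negbT.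
    by rewrite negb_or negbK => /andP[-> /negP].
  move=> [H1 /negP H2]; apply/negPn; rewrite first_time_before negb_or.
  by rewrite -/(inhomogeneous_time xi q w) H1.
elim=> [|k IH] kn.
  rewrite step; apply: measurableI; last by apply: measurableC; exact: ms.
  rewrite [X in measurable X](_ : _ = setT)//; apply/seteqP; split => // w _ /=.
  by case: (inhomogeneous_time xi q w).
rewrite step; apply: measurableI; last by apply: measurableC; exact: ms.
by apply: IH; exact: ltnW.
Qed.

Lemma history_measurable (xi : nat -> {mfun Om >-> R}) n :
  history X xi n `<=` measurable.
Proof.
apply: smallest_sub; first exact: sigma_algebra_measurable.
by move=> A []; exact: sigma_of_measurable.
Qed.

Lemma measurable_not_before (xi : nat -> {mfun Om >-> R}) (tau : Om -> time) n :
  stopping_time X xi tau -> measurable_fun setT (fun w => not_before (tau w) n).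
Proof.
move=> st; apply: (measurable_fun_bool true); rewrite setTI.
case: n => [|n].
  rewrite [X in measurable X](_ : _ = setT)//; apply/seteqP; split => // w _ /=.
  by case: (tau w).
rewrite -[X in measurable X]setCK -[X in measurable (~` X)]not_before_set.
by apply: measurableC; exact: history_measurable (st n).
Qed.

Lemma measurable_time_eq (xi : nat -> {mfun Om >-> R}) (tau : Om -> time) n :
  stopping_time X xi tau -> measurable_fun setT (fun w => tau w == Some n).
Proof.
move=> st; under eq_fun do rewrite time_eqE.
by apply: measurable_and; [|apply: measurable_neg]; exact: measurable_not_before st.
Qed.

Variables (xi1 xi2 : nat -> {mfun Om >-> R}) (T : {mfun Om >-> nat}).
Local Notation info := (info X xi1 xi2 T).

Lemma info_setC I N A : info I N A -> info I N (~` A).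
Proof.
rewrite -info_id; exact: (@measurableC _ (g_sigma_algebraType (info I N))).
Qed.

Lemma info_setI I N A B : info I N A -> info I N B -> info I N (A `&` B).
Proof.
exact: (sigma_algebra_pi_system (info_sigma_algebra X xi1 xi2 T I N)).2.
Qed.

Lemma history_info (xi : nat -> {mfun Om >-> R}) n N :
  (forall k, (k <= n)%N -> preimage_set_system setT (xi k) measurable `<=`
     info `I_n.+1 N) ->
  history X xi n `<=` info `I_n.+1 N.
Proof.
move=> H; apply: smallest_sub; first exact: info_sigma_algebra.
move=> A [|]; first exact: (@info_le _ _ _ _ _ X xi1 xi2 T _ 0 N (leq0n N)).
apply: smallest_sub; first exact: info_sigma_algebra.
by move=> B [k /= kn]; exact: H.
Qed.

Lemma history1_info n : history X xi1 n `<=` info `I_n.+1 n.*2.+2.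
Proof.
apply: history_info => k kn; have := @source_info _ _ _ _ _ X xi1 xi2 T
  `I_n.+1 k.*2.+1 n.*2.+2; rewrite noise_source1; apply.
by rewrite !ltnS leq_double.
Qed.

Lemma history2_info n : history X xi2 n `<=` info `I_n.+1 n.*2.+3.
Proof.
apply: history_info => k kn; have := @source_info _ _ _ _ _ X xi1 xi2 T
  `I_n.+1 k.*2.+2 n.*2.+3; rewrite noise_source2; apply.
by rewrite !ltnS leq_double.
Qed.

(** Whether to stop before n is decided by the states and noises of the dates before
    n; hence the noises of date n, numbered from 2n+1, are independent of it. *)
Lemma not_before_info (xi : nat -> {mfun Om >-> R}) (tau : Om -> time) n :
  (forall m, history X xi m `<=` info `I_m.+1 m.*2.+3) ->
  stopping_time X xi tau -> info `I_n n.*2.+1 [set w | not_before (tau w) n].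
Proof.
move=> H st; case: n => [|n].
  rewrite [X in info _ _ X](_ : _ = setT).
    exact: (sigma_algebra_pi_system (info_sigma_algebra X xi1 xi2 T _ _)).1.
  by apply/seteqP; split => // w _ /=; case: (tau w).
rewrite doubleS -[X in info _ _ X]setCK -not_before_set.
exact: info_setC (H n _ (st n)).
Qed.

Lemma not_before_info1 (tau : Om -> time) n : stopping_time X xi1 tau ->
  info `I_n n.*2.+1 [set w | not_before (tau w) n].
Proof.
apply: not_before_info => m A /history1_info; exact: info_step.
Qed.

Lemma not_before_info2 (tau : Om -> time) n : stopping_time X xi2 tau ->
  info `I_n n.*2.+1 [set w | not_before (tau w) n].
Proof. by apply: not_before_info => m; exact: history2_info. Qed.

(** The decision of player 1 at date n uses noises up to the number 2n+1, and so is
    independent of the noise 2n+2 of player 2. *)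
Lemma not_beforeS_info1 (tau : Om -> time) n : stopping_time X xi1 tau ->
  info `I_n.+1 n.*2.+2 [set w | not_before (tau w) n.+1].
Proof.
move=> st; rewrite -[X in info _ _ X]setCK -not_before_set.
exact: info_setC (history1_info (st n)).
Qed.

End stopping_times.

(** * Payoffs as sums of gains *)

Lemma indic_bool (T : Type) (R : pzRingType) (B : T -> bool) w :
  \1_[set w | B w] w = (B w)%:R :> R.
Proof.
by rewrite indicE; congr (_%:R); congr nat_of_bool; apply/idP/idP => [/set_mem|/mem_set].
Qed.

Section payoffs.
Context {d d' : measure_display} {R : realType}.
Context {Om : measurableType d} {E : measurableType d'}.
Variables (P : E -> probability Om R) (X : nat -> {mfun Om >-> E}).
Variables (xi1 xi2 : nat -> {mfun Om >-> R}) (T : {mfun Om >-> nat}).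
Variables (alpha : R) (f g h : E -> R).
Hypothesis alpha01 : 0 < alpha < 1.
Hypothesis T_geom : forall x k,
  P x [set w | T w = k] = ((1 - alpha) * alpha ^+ k)%:E.
Hypothesis indep : forall x, mutual_independence (P x) (source_sigma X xi1 xi2 T).
Hypothesis mf : measurable_fun setT f.
Hypothesis mg : measurable_fun setT g.
Hypothesis mh : measurable_fun setT h.
Hypothesis f_L1 : sup_killed_L1 P X T f.
Hypothesis g_L1 : sup_killed_L1 P X T g.
Hypothesis h_L1 : sup_killed_L1 P X T h.

Variables (tau1 tau2 : Om -> time).

Definition payoff (w : Om) : R :=
  discounted X alpha f (tau1 w) w * (time_lt (tau1 w) (tau2 w))%:R
  + discounted X alpha g (tau2 w) w * (time_lt (tau2 w) (tau1 w))%:R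
  + discounted X alpha h (tau1 w) w
      * ((tau1 w == tau2 w) && (tau1 w != None))%:R.

(** The part of the payoff that is received at date n: [not_before _ n.+1] says that
    the opponent stops later. *)
Definition gain (n : nat) (w : Om) : R := alpha ^+ n *
  (((tau1 w == Some n) && not_before (tau2 w) n.+1)%:R * f (X n w)
   + ((tau2 w == Some n) && not_before (tau1 w) n.+1)%:R * g (X n w)
   + ((tau1 w == Some n) && (tau2 w == Some n))%:R * h (X n w)).

Definition live (n : nat) (w : Om) : bool :=
  not_before (tau1 w) n && not_before (tau2 w) n.

(** The whole payoff is received in the round in which the game ends. *)
Lemma sum_gain N w : \sum_(n < N) gain n w = payoff w * (~~ live N w)%:R.
Proof.
elim: N => [|N IH].
  by rewrite big_ord0 /live; case: (tau1 w) (tau2 w) => [a|] [b|]; rewrite /= mulr0.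
rewrite big_ord_recr /= {}IH /gain /payoff /live.
case: (tau1 w) (tau2 w) => [a|] [b|] /=; last by rewrite !(mulr0, mul0r, addr0, add0r).
- rewrite !(inj_eq Some_inj).
  case: (ltngtP a N) => [aN|Na|->]; case: (ltngtP b N) => [bN|Nb|->];
    rewrite ?ltnn ?eqxx ?leqnn ?(gtn_eqF Nb) ?(ltn_eqF Nb) ?(gtn_eqF bN) /=; try ring.
  by rewrite Na ltnNge (ltnW Na) (gtn_eqF Na) /=; ring.
- rewrite !(inj_eq Some_inj).
  by case: (ltngtP a N) => [aN|Na|->] /=; ring.
- rewrite !(inj_eq Some_inj).
  by case: (ltngtP b N) => [bN|Nb|->] /=; ring.
Qed.

Hypothesis st1 : stopping_time X xi1 tau1.
Hypothesis st2 : stopping_time X xi2 tau2.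

Lemma measurable_live n : measurable_fun setT (live n).
Proof.
by apply: measurable_and; [exact: measurable_not_before st1|exact: measurable_not_before st2].
Qed.

Lemma L1_bool x (B : Om -> bool) (Z : Om -> R) : measurable_fun setT B ->
  L1 (P x) Z -> L1 (P x) (fun w => (B w)%:R * Z w).
Proof.
move=> mB; apply: L1M01; last by move=> w; rewrite ler0n lern1 leq_b1.
exact: (measurableT_comp (f := fun b : bool => b%:R : R)).
Qed.

Let f_path : path_L1 P X f := sup_killed_path_L1 alpha01 T_geom indep mf f_L1.
Let g_path : path_L1 P X g := sup_killed_path_L1 alpha01 T_geom indep mg g_L1.
Let h_path : path_L1 P X h := sup_killed_path_L1 alpha01 T_geom indep mh h_L1.

Lemma gain_L1 x n : L1 (P x) (gain n).
Proof.
apply: L1Z; apply: L1D; first apply: L1D; apply: L1_bool.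
- by apply: measurable_and; [exact: measurable_time_eq st1|exact: measurable_not_before st2].
- exact: f_path.2.
- by apply: measurable_and; [exact: measurable_time_eq st2|exact: measurable_not_before st1].
- exact: g_path.2.
- by apply: measurable_and; [exact: measurable_time_eq st1|exact: measurable_time_eq st2].
- exact: h_path.2.
Qed.

Let envelopes w : \bar R :=
  (envelope alpha X f w + envelope alpha X g w + envelope alpha X h w)%E.

Lemma payoff_le w : (`|payoff w|%:E <= envelopes w)%E.
Proof.
have e0 u := envelope_ge0 alpha01 X u w.
have ef n : (`|alpha ^+ n * f (X n w)|%:E <= envelopes w)%E.
  apply: le_trans (envelope_ge alpha01 X f n w) _.
  by rewrite /envelopes -addeA leeDl// adde_ge0.
have eg n : (`|alpha ^+ n * g (X n w)|%:E <= envelopes w)%E.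
  apply: le_trans (envelope_ge alpha01 X g n w) _.
  by rewrite /envelopes addeAC leeDr// adde_ge0.
have eh n : (`|alpha ^+ n * h (X n w)|%:E <= envelopes w)%E.
  apply: le_trans (envelope_ge alpha01 X h n w) _.
  by rewrite /envelopes leeDr// adde_ge0.
have e00 : (0 <= envelopes w)%E by rewrite /envelopes !adde_ge0.
rewrite /payoff; case: (tau1 w) (tau2 w) => [a|] [b|] /=;
  rewrite ?(mulr0, mul0r, addr0, add0r, mulr1, normr0)//.
rewrite (inj_eq Some_inj) andbT.
by case: (ltngtP a b) => [_|_|->]; rewrite ?(mulr0, mul0r, addr0, add0r, mulr1).
Qed.

(** Dominated convergence, the sum of the envelopes of f, g and h being the bound. *)
Lemma payoff_limit x : L1 (P x) payoff /\
  \sum_(n < N) \int[P x]_w gain n w @[N --> \oo] --> \int[P x]_w payoff w.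
Proof.
have sumE N : L1 (P x) (fun w => \sum_(n < N) gain n w) /\
    \int[P x]_w (\sum_(n < N) gain n w) = \sum_(n < N) \int[P x]_w gain n w.
  elim: N => [|N [iS IH]].
    rewrite (_ : (fun w => _) = cst 0); last by apply/funext => w; rewrite big_ord0.
    rewrite big_ord0 Rintegral_cst// mul0r; split=> //.
    exact: finite_measure_integrable_cst.
  rewrite (_ : (fun w => _) = fun w => \sum_(n < N) gain n w + gain N w); last first.
    by apply/funext => w; rewrite big_ord_recr.
  split; first by apply: L1D => //; exact: gain_L1.
  by rewrite big_ord_recr /= RintegralD// ?IH//; exact: gain_L1.
have lim w : \sum_(n < N) gain n w @[N --> \oo] --> payoff w.
  have [N0 HN0] : exists N0, forall N, (N0 <= N)%N ->
      \sum_(n < N) gain n w = payoff w.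
    have [[m e1]|[[m e2]|[e1 e2]]] : (exists m, tau1 w = Some m) \/
        (exists m, tau2 w = Some m) \/ (tau1 w = None /\ tau2 w = None).
      case: (tau1 w) => [a|]; first by left; exists a.
      case: (tau2 w) => [b|]; first by right; left; exists b.
      by right; right.
    - exists m.+1 => N mN; rewrite sum_gain /live e1 /=.
      by rewrite leqNgt mN /= mulr1.
    - exists m.+1 => N mN; rewrite sum_gain /live e2 /=.
      by rewrite [(N <= m)%N]leqNgt mN andbF /= mulr1.
    - exists 0%N => N _; rewrite sum_gain /payoff e1 e2 /=.
      by rewrite !(mulr0, mul0r, addr0).
  apply: cvg_near_cst; exists N0 => // N /= ?; exact: HN0.
have mpay : measurable_fun setT payoff.
  apply: (measurable_fun_cvg (h := fun N w => \sum_(n < N) gain n w)) => //.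
  by move=> N; exact: (L1_measurable (sumE N).1).
have ienv : (P x).-integrable setT envelopes.
  apply: integrableD => //; first apply: integrableD => //; exact: integrable_envelope.
have [] := @dominated_convergence _ _ _ (P x) setT measurableT
  (fun N w => (\sum_(n < N) gain n w)%:E) (EFin \o payoff) envelopes.
- by move=> N; apply/measurable_EFinP; exact: (L1_measurable (sumE N).1).
- exact/measurable_EFinP.
- by apply: aeW => w _; apply: cvg_EFin; [exact: nearW|exact: lim].
- exact: ienv.
- apply: aeW => w N _; rewrite sum_gain /=; case: (live N w); rewrite /= ?mulr1 ?mulr0.
    by rewrite normr0 (le_trans _ (payoff_le w))// lee_fin.
  exact: payoff_le.
move=> ipay _ cv; split=> //.
have fpay : ((\int[P x]_w payoff w)%:E = \int[P x]_w (payoff w)%:E)%E.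
  by rewrite /Rintegral fineK//; exact: integrable_fin_num.
rewrite [X in X x @[x --> \oo]](_ : _ =
    fine \o fun N => (\int[P x]_w (\sum_(n < N) gain n w)%:E)%E).
  by apply: fine_cvg; rewrite fpay.
by apply/funext => N /=; rewrite -(sumE N).2.
Qed.

Lemma J1_payoff x : J1 P X alpha f g h x tau1 tau2 = (\int[P x]_w payoff w)%:E.
Proof.
have [ip _] := payoff_limit x.
rewrite /Rintegral fineK; last exact: integrable_fin_num.
by rewrite /J1 unlock.
Qed.

End payoffs.

(** * One round against a randomizing opponent *)

Section randomized_opponent.
Context {d d' : measure_display} {R : realType}.
Context {Om : measurableType d} {E : measurableType d'}.
Variables (P : E -> probability Om R) (Pi : R.-pker E ~> E).
Variables (X : nat -> {mfun Om >-> E}) (xi1 xi2 : nat -> {mfun Om >-> R}).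
Variables (T : {mfun Om >-> nat}) (alpha : R) (f g h : E -> R).
Hypothesis X_markov : markov_process P Pi X.
Hypothesis xi2_unif : forall x n, uniform01 (P x) (xi2 n).
Hypothesis indep : forall x, mutual_independence (P x) (source_sigma X xi1 xi2 T).
Hypothesis f_path : path_L1 P X f.
Hypothesis g_path : path_L1 P X g.
Hypothesis h_path : path_L1 P X h.

Variables (tau1 : Om -> time) (q : nat -> E -> R).
Hypothesis st1 : stopping_time X xi1 tau1.
Hypothesis mq : forall n, measurable_fun setT (q n).
Hypothesis q01 : forall n y, 0 <= q n y <= 1.

Local Notation tau2 := (inhomogeneous_time X xi2 q).
Local Notation gain := (gain X alpha f g h tau1 tau2).
Local Notation live := (live tau1 tau2).
Let st2 : stopping_time X xi2 tau2 :=
  @stopping_inhomogeneous_time _ _ _ _ _ X xi2 q mq.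

Local Notation stop2 n w := (xi2 n%N w <= q n%N (X n%N w))%R.
Local Notation at1 n w := ((tau1 w == Some n%N) && not_before (tau2 w) n%N).
Local Notation after1 n w := (not_before (tau1 w) n.+1 && not_before (tau2 w) n%N).

Lemma inhomogeneous_timeS n w :
  not_before (tau2 w) n.+1 = not_before (tau2 w) n && ~~ stop2 n w.
Proof. by apply: negb_inj; rewrite first_time_before negb_and negbK. Qed.

Lemma inhomogeneous_time_eq n w :
  (tau2 w == Some n) = not_before (tau2 w) n && stop2 n w.
Proof.
by rewrite time_eqE inhomogeneous_timeS negb_and negbK andb_orr andbN.
Qed.

Let after1_info n : info X xi1 xi2 T `I_n.+1 n.*2.+2 [set w | after1 n w].
Proof.
have -> : [set w | after1 n w] =
    [set w | not_before (tau1 w) n.+1] `&` [set w | not_before (tau2 w) n].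
  by apply/seteqP; split => w /=; [move/andP|move=> [? ?]; apply/andP].
apply: info_setI; first exact: not_beforeS_info1.
apply: info_step; have := @not_before_info2 _ _ _ _ _ X xi1 xi2 T _ n st2.
by apply: info_subset => k /= /ltnW.
Qed.

Let at1_info n : info X xi1 xi2 T `I_n.+1 n.*2.+2 [set w | at1 n w].
Proof.
have -> : [set w | at1 n w] = [set w | not_before (tau1 w) n] `&`
    ~` [set w | not_before (tau1 w) n.+1] `&` [set w | not_before (tau2 w) n].
  apply/seteqP; split => w /=; rewrite time_eqE.
    by move=> /andP[/andP[? /negP ?] ?].
  by move=> [[-> /negP ->] ->].
have mono A : info X xi1 xi2 T `I_n n.*2.+1 A -> info X xi1 xi2 T `I_n.+1 n.*2.+2 A.
  by move=> hA; apply: info_step; apply: info_subset hA => k /= /ltnW.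
apply: info_setI; first apply: info_setI.
- by apply: mono; exact: not_before_info1.
- by apply: info_setC; exact: not_beforeS_info1.
- by apply: mono; exact: not_before_info2.
Qed.

Let measurable_bool I N (B : Om -> bool) : info X xi1 xi2 T I N [set w | B w] ->
  measurable_fun setT B.
Proof.
move=> hB; apply: (measurable_fun_bool true); rewrite setTI.
exact: info_measurable hB.
Qed.

Let mstop2 n : measurable_fun setT (fun w => stop2 n w).
Proof.
apply: measurable_fun_ler; first exact: measurable_funP.
exact: (measurable_path X n (mq n)).
Qed.

Let freeze2 x n (B : Om -> bool) u :
  info X xi1 xi2 T `I_n.+1 n.*2.+2 [set w | B w] -> path_L1 P X u ->
  \int[P x]_w ((stop2 n w)%:R * ((B w)%:R * u (X n w))) =
  \int[P x]_w (q n (X n w) * ((B w)%:R * u (X n w))).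
Proof.
move=> hB gu.
under [LHS]eq_Rintegral do rewrite -indic_bool -indic_bool.
under [RHS]eq_Rintegral do rewrite -indic_bool.
under [LHS]eq_Rintegral do rewrite indic_bool.
have F2 : source_sigma X xi1 xi2 T (noise_source n.*2.+2) =
    preimage_set_system setT (xi2 n) measurable by rewrite noise_source2.
apply: (freeze_step indep n (xi2_unif x n) F2) => //.
exact: info_subset hB.
Qed.

Let L1q x n (Z : Om -> R) : L1 (P x) Z -> L1 (P x) (fun w => q n (X n w) * Z w).
Proof. by apply: L1M01 => //; exact: (measurable_path X n (mq n)). Qed.

Let L1b x n (Z : Om -> R) : L1 (P x) Z -> L1 (P x) (fun w => (stop2 n w)%:R * Z w).
Proof. exact: L1_bool. Qed.

Let L1at x n u : path_L1 P X u -> L1 (P x) (fun w => (at1 n w)%:R * u (X n w)).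
Proof.
move=> gu; apply: L1_bool; last exact: gu.2.
exact: (@measurable_bool _ _ _ (@at1_info n)).
Qed.

Let L1after x n m u : path_L1 P X u -> L1 (P x) (fun w => (after1 n w)%:R * u (X m w)).
Proof.
move=> gu; apply: L1_bool; last exact: gu.2.
exact: (@measurable_bool _ _ _ (@after1_info n)).
Qed.

Let expected_gain x n : \int[P x]_w gain n w = alpha ^+ n *
  (\int[P x]_w ((at1 n w)%:R * f (X n w))
   - \int[P x]_w (q n (X n w) * ((at1 n w)%:R * f (X n w)))
   + \int[P x]_w (q n (X n w) * ((at1 n w)%:R * h (X n w)))
   + \int[P x]_w (q n (X n w) * ((after1 n w)%:R * g (X n w)))).
Proof.
rewrite -!freeze2//.
have i1 := L1at x n f_path; have i2 := L1b n i1.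
have i3 := L1b n (L1at x n h_path); have i4 := L1b n (L1after x n n g_path).
rewrite -RintegralB// -RintegralD//; last exact: L1B.
rewrite -RintegralD//; last by apply: L1D => //; exact: L1B.
rewrite -RintegralZl//; last by do 2 apply: L1D => //; exact: L1B.
apply: eq_Rintegral => w _; rewrite /gain.
rewrite inhomogeneous_time_eq inhomogeneous_timeS.
case: (tau1 w == Some n); case: (not_before (tau2 w) n); case: (stop2 n w);
  case: (not_before (tau1 w) n.+1) => /=; ring.
Qed.

Let expected_continuation x n u : path_L1 P X u ->
  \int[P x]_w ((live n.+1 w)%:R * u (X n.+1 w)) =
  \int[P x]_w ((after1 n w)%:R * kernel_op Pi u (X n w))
  - \int[P x]_w (q n (X n w) * ((after1 n w)%:R * kernel_op Pi u (X n w))).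
Proof.
move=> gu; have gK := path_L1_kernel_op X_markov indep gu.
have lE w : live n.+1 w = after1 n w && ~~ stop2 n w.
  by rewrite /live inhomogeneous_timeS andbA.
have hlive : info X xi1 xi2 T `I_n.+1 n.*2.+3 [set w | live n.+1 w].
  have -> : [set w | live n.+1 w] =
      [set w | not_before (tau1 w) n.+1] `&` [set w | not_before (tau2 w) n.+1].
    by apply/seteqP; split => w /=; [move/andP|move=> [? ?]; apply/andP].
  apply: info_setI; first by apply: info_step; exact: not_beforeS_info1.
  by have := @not_before_info2 _ _ _ _ _ X xi1 xi2 T _ n.+1 st2; apply.
transitivity (\int[P x]_w (\1_[set w | live n.+1 w] w * u (X n.+1 w))).
  by apply: eq_Rintegral => w _; rewrite indic_bool.
rewrite (markov_step X_markov indep x hlive gu) -freeze2//.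
rewrite -RintegralB//; last 2 first.
- exact: L1after.
- by apply: L1b; exact: L1after.
apply: eq_Rintegral => w _; rewrite indic_bool lE.
by case: (after1 n w); case: (stop2 n w) => /=; ring.
Qed.

(** The moves of date n are integrated out from the last to the first: the next state
    by the Markov step, possible because the game being still live at n+1 is an event
    of the history of date n, and then the noise of player 2 by [freeze_step],
    which leaves the decision of player 1 as it is. *)
Lemma one_step x n u : path_L1 P X u ->
  \int[P x]_w gain n w +
    alpha ^+ n.+1 * \int[P x]_w ((live n.+1 w)%:R * u (X n.+1 w)) =
  alpha ^+ n * \int[P x]_w (
    (at1 n w)%:R * stop_val (q n) f h (X n w) +
    (after1 n w)%:R * cont_val Pi alpha (q n) g u (X n w)).
Proof.
move=> gu; have gK := path_L1_kernel_op X_markov indep gu.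
rewrite expected_gain expected_continuation//.
set If := \int[P x]_w _; set Iqf := \int[P x]_w _; set Iqh := \int[P x]_w _.
set Iqg := \int[P x]_w _; set IK := \int[P x]_w _; set IqK := \int[P x]_w _.
suff -> : \int[P x]_w (
    (at1 n w)%:R * stop_val (q n) f h (X n w) +
    (after1 n w)%:R * cont_val Pi alpha (q n) g u (X n w)) =
    If - Iqf + Iqh + (alpha * (IK - IqK) + Iqg).
  by rewrite exprS; ring.
have i1 := L1at x n f_path; have i2 := L1q n i1.
have i3 := L1q n (L1at x n h_path); have i4 := L1q n (L1after x n n g_path).
have i5 := L1after x n n gK; have i6 := L1q n i5.
rewrite /If /Iqf /Iqh /Iqg /IK /IqK.
rewrite -RintegralB// -RintegralD//; last exact: L1B.
rewrite -RintegralB// -RintegralZl//; last exact: L1B.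
rewrite -RintegralD//; last by apply: L1Z; exact: L1B.
rewrite -RintegralD//; last 2 first.
- by apply: L1D => //; exact: L1B.
- by apply: L1D => //; apply: L1Z; exact: L1B.
by apply: eq_Rintegral => w _; rewrite /stop_val /cont_val; ring.
Qed.

End randomized_opponent.

(** * Rounds in which both players randomize *)

Section randomized_players.
Context {d d' : measure_display} {R : realType}.
Context {Om : measurableType d} {E : measurableType d'}.
Variables (P : E -> probability Om R) (Pi : R.-pker E ~> E).
Variables (X : nat -> {mfun Om >-> E}) (xi1 xi2 : nat -> {mfun Om >-> R}).
Variables (T : {mfun Om >-> nat}) (alpha : R) (f g h : E -> R).
Hypothesis X_markov : markov_process P Pi X.
Hypothesis xi1_unif : forall x n, uniform01 (P x) (xi1 n).
Hypothesis xi2_unif : forall x n, uniform01 (P x) (xi2 n).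
Hypothesis indep : forall x, mutual_independence (P x) (source_sigma X xi1 xi2 T).
Hypothesis f_path : path_L1 P X f.
Hypothesis g_path : path_L1 P X g.
Hypothesis h_path : path_L1 P X h.

Lemma path_L1_stop_val (q u v : E -> R) : measurable_fun setT q ->
  (forall y, 0 <= q y <= 1) -> path_L1 P X u -> path_L1 P X v ->
  path_L1 P X (stop_val q u v).
Proof.
move=> mq q01 gu gv; apply: path_L1D; apply: path_L1M01 => //.
  exact: measurable_funB.
by move=> y; have /andP[q0 q1] := q01 y; rewrite subr_ge0 q1 lerBlDr lerDl.
Qed.

Lemma path_L1_cont_val (q u v : E -> R) : measurable_fun setT q ->
  (forall y, 0 <= q y <= 1) -> path_L1 P X u -> path_L1 P X v ->
  path_L1 P X (cont_val Pi alpha q u v).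
Proof.
move=> mq q01 gu gv.
have -> : cont_val Pi alpha q u v = stop_val q (fun y => alpha * kernel_op Pi v y) u.
  by apply/funext => y; rewrite /cont_val /stop_val mulrA.
apply: path_L1_stop_val => //; apply: path_L1Z; exact: path_L1_kernel_op.
Qed.

Variables (p q : nat -> E -> R).
Hypothesis mp : forall n, measurable_fun setT (p n).
Hypothesis p01 : forall n y, 0 <= p n y <= 1.
Hypothesis mq : forall n, measurable_fun setT (q n).
Hypothesis q01 : forall n y, 0 <= q n y <= 1.

Local Notation tau1 := (inhomogeneous_time X xi1 p).
Local Notation tau2 := (inhomogeneous_time X xi2 q).
Local Notation gain := (gain X alpha f g h tau1 tau2).
Local Notation live := (live tau1 tau2).
Local Notation stop1 n w := (xi1 n%N w <= p n%N (X n%N w))%R.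

Let st1 : stopping_time X xi1 tau1 :=
  @stopping_inhomogeneous_time _ _ _ _ _ X xi1 p mp.
Let st2 : stopping_time X xi2 tau2 :=
  @stopping_inhomogeneous_time _ _ _ _ _ X xi2 q mq.

Definition mixed_val (n : nat) (u : E -> R) (y : E) : R :=
  p n y * stop_val (q n) f h y + (1 - p n y) * cont_val Pi alpha (q n) g u y.

Let live_info n : info X xi1 xi2 T setT n.*2.+1 [set w | live n w].
Proof.
have -> : [set w | live n w] =
    [set w | not_before (tau1 w) n] `&` [set w | not_before (tau2 w) n].
  by apply/seteqP; split => w /=; [move/andP|move=> [? ?]; apply/andP].
apply: (@info_subset _ _ _ _ _ _ _ _ _ `I_n) => //; apply: info_setI.
  exact: not_before_info1.
exact: not_before_info2.
Qed.

Let freeze1 x n u : path_L1 P X u ->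
  \int[P x]_w ((stop1 n w)%:R * ((live n w)%:R * u (X n w))) =
  \int[P x]_w (p n (X n w) * ((live n w)%:R * u (X n w))).
Proof.
move=> gu.
have F1 : source_sigma X xi1 xi2 T (noise_source n.*2.+1) =
    preimage_set_system setT (xi1 n) measurable by rewrite noise_source1.
have := freeze_step indep n (xi1_unif x n) F1 (@live_info n) (mp n) (p01 n) gu.
under eq_Rintegral do rewrite indic_bool.
by under [in X in _ = X -> _]eq_Rintegral do rewrite indic_bool.
Qed.

(** After [one_step] only the decision of player 1 is left; it is frozen in turn,
    since the game being live at n does not depend on the noises of date n. *)
Lemma one_step_mixed x n u : path_L1 P X u ->
  \int[P x]_w gain n w +
    alpha ^+ n.+1 * \int[P x]_w ((live n.+1 w)%:R * u (X n.+1 w)) =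
  alpha ^+ n * \int[P x]_w ((live n w)%:R * mixed_val n u (X n w)).
Proof.
move=> gu; rewrite (one_step _ X_markov xi2_unif indep)//; congr (_ * _).
have gs := path_L1_stop_val (mq n) (q01 n) f_path h_path.
have gc := path_L1_cont_val (mq n) (q01 n) g_path gu.
have mstop1 : measurable_fun setT (fun w => stop1 n w).
  apply: measurable_fun_ler; first exact: measurable_funP.
  exact: (measurable_path X n (mp n)).
have mlive : measurable_fun setT (live n).
  apply: (measurable_fun_bool true); rewrite setTI.
  exact: info_measurable (@live_info n).
have iL u' : path_L1 P X u' -> L1 (P x) (fun w => (live n w)%:R * u' (X n w)).
  by move=> gu'; apply: L1_bool => //; exact: gu'.2.
have iS u' : path_L1 P X u' ->
    L1 (P x) (fun w => (stop1 n w)%:R * ((live n w)%:R * u' (X n w))).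
  by move=> gu'; apply: L1_bool => //; exact: iL.
have iP u' : path_L1 P X u' ->
    L1 (P x) (fun w => p n (X n w) * ((live n w)%:R * u' (X n w))).
  move=> gu'; apply: L1M01 => //; last exact: iL.
  exact: (measurable_path X n (mp n)).
have timeE w : ((tau1 w == Some n) && not_before (tau2 w) n = live n w && stop1 n w) *
    (not_before (tau1 w) n.+1 && not_before (tau2 w) n = live n w && ~~ stop1 n w).
  rewrite inhomogeneous_time_eq inhomogeneous_timeS /live.
  by split; rewrite andbAC.
transitivity (\int[P x]_w ((stop1 n w)%:R * ((live n w)%:R * stop_val (q n) f h (X n w)))
  + (\int[P x]_w ((live n w)%:R * cont_val Pi alpha (q n) g u (X n w))
  - \int[P x]_w ((stop1 n w)%:R * ((live n w)%:R * cont_val Pi alpha (q n) g u (X n w))))).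
  rewrite -RintegralB//; [|exact: iL|exact: iS].
  rewrite -RintegralD//; [|exact: iS|by apply: L1B; [exact: iL|exact: iS]].
  apply: eq_Rintegral => w _; rewrite !timeE.
  by case: (live n w); case: (stop1 n w) => /=; ring.
rewrite !freeze1//.
rewrite -RintegralB//; [|exact: iL|exact: iP].
rewrite -RintegralD//; [|exact: iP|by apply: L1B; [exact: iL|exact: iP]].
by apply: eq_Rintegral => w _; rewrite /mixed_val; ring.
Qed.

(** The equality of [one_step_mixed] telescopes along a sequence of values that is
    consistent with the rounds. *)
Lemma backward_induction x N (v : nat -> E -> R) :
  (forall n, path_L1 P X (v n)) ->
  (forall n, (n < N)%N -> v n = mixed_val n (v n.+1)) ->
  \sum_(n < N) \int[P x]_w gain n w +
    alpha ^+ N * \int[P x]_w ((live N w)%:R * v N (X N w)) = v 0%N x.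
Proof.
move=> gv; elim: N => [|N IH] vE.
  rewrite big_ord0 expr0 add0r mul1r -[RHS](start_expectation X_markov x (gv 0%N).1).
  apply: eq_Rintegral => w _; rewrite /live.
  by case: (tau1 w) (tau2 w) => [?|] [?|]; rewrite mul1r.
rewrite big_ord_recr /= -addrA one_step_mixed// -vE//; apply: IH => n nN.
by apply: vE; exact: ltnW.
Qed.

End randomized_players.

(** * Verification *)

Lemma sup_killed_L1_norm d d' (R : realType) (Om : measurableType d)
    (E : measurableType d') (P : E -> probability Om R)
    (X : nat -> {mfun Om >-> E}) (T : {mfun Om >-> nat}) (u v : E -> R) :
  (forall y, `|u y| = `|v y|) -> sup_killed_L1 P X T u -> sup_killed_L1 P X T v.
Proof.
move=> uv H x; have := H x; congr integrable; apply/funext => w.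
congr (ereal_sup _); congr image; apply/funext => n; congr EFin.
by rewrite /killed; case: ifP => //= _; rewrite uv.
Qed.

Section verification.
Context {d d' : measure_display} {R : realType}.
Context {Om : measurableType d} {E : measurableType d'}.
Variables (P : E -> probability Om R) (Pi : R.-pker E ~> E).
Variables (X : nat -> {mfun Om >-> E}) (xi1 xi2 : nat -> {mfun Om >-> R}).
Variables (T : {mfun Om >-> nat}) (alpha : R) (f g h : E -> R).
Hypothesis alpha01 : 0 < alpha < 1.
Hypothesis mf : measurable_fun setT f.
Hypothesis mg : measurable_fun setT g.
Hypothesis mh : measurable_fun setT h.
Hypothesis X_markov : markov_process P Pi X.
Hypothesis xi1_unif : forall x n, uniform01 (P x) (xi1 n).
Hypothesis xi2_unif : forall x n, uniform01 (P x) (xi2 n).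
Hypothesis T_geom : forall x k,
  P x [set w | T w = k] = ((1 - alpha) * alpha ^+ k)%:E.
Hypothesis indep : forall x, mutual_independence (P x) (source_sigma X xi1 xi2 T).
Hypothesis f_L1 : sup_killed_L1 P X T f.
Hypothesis g_L1 : sup_killed_L1 P X T g.
Hypothesis h_L1 : sup_killed_L1 P X T h.

Let f_path : path_L1 P X f := sup_killed_path_L1 alpha01 T_geom indep mf f_L1.
Let g_path : path_L1 P X g := sup_killed_path_L1 alpha01 T_geom indep mg g_L1.
Let h_path : path_L1 P X h := sup_killed_path_L1 alpha01 T_geom indep mh h_L1.

Variables (V : E -> R).
Hypothesis mV : measurable_fun setT V.
Hypothesis V_L1 : sup_killed_L1 P X T V.

Let V_path : path_L1 P X V := sup_killed_path_L1 alpha01 T_geom indep mV V_L1.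

Section live_limit.
Variables tau1 tau2 : Om -> time.
Hypothesis st1 : stopping_time X xi1 tau1.
Hypothesis st2 : stopping_time X xi2 tau2.

Let liveV_L1 x n : L1 (P x) (fun w => (live tau1 tau2 n w)%:R * V (X n w)).
Proof. by apply: L1_bool; [exact: (measurable_live st1 st2)|exact: V_path.2]. Qed.

Lemma live_discounted_cvg0 x :
  alpha ^+ n * \int[P x]_w ((live tau1 tau2 n w)%:R * V (X n w)) @[n --> \oo] --> 0.
Proof.
have /andP[a0 a1] := alpha01.
apply/norm_cvg0P; apply: (squeeze_cvgr _ (cvg_cst 0)
  (discounted_mean_cvg0 alpha01 T_geom indep mV V_L1 x)).
apply: nearW => n; rewrite normr_ge0 /= normrM ger0_norm ?exprn_ge0 ?(ltW a0)//.
apply: ler_wpM2l; first by rewrite exprn_ge0// ltW.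
apply: le_trans (le_normr_Rintegral measurableT (liveV_L1 x n)) _.
apply: le_Rintegral => //; first exact: L1_norm.
  exact: (path_L1_norm V_path).2.
move=> w _; rewrite normrM; case: (live _ _ n w) => /=.
  by rewrite normr1 mul1r.
by rewrite normr0 mul0r.
Qed.

End live_limit.

Variables (p1 p2 : E -> R).
Hypothesis mp1 : measurable_fun setT p1.
Hypothesis mp2 : measurable_fun setT p2.
Hypothesis p1_01 : forall y, 0 <= p1 y <= 1.
Hypothesis p2_01 : forall y, 0 <= p2 y <= 1.

Lemma markov_timeE (xi : nat -> {mfun Om >-> R}) (p : E -> R) :
  markov_time X xi p = inhomogeneous_time X xi (fun=> p).
Proof. by []. Qed.

Lemma stopping_markov_time (xi : nat -> {mfun Om >-> R}) (p : E -> R) : measurable_fun setT p ->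
  stopping_time X xi (markov_time X xi p).
Proof. by move=> mp; apply: (@stopping_inhomogeneous_time _ _ _ _ _ X xi (fun=> p)). Qed.

(** By [one_step] the two inequalities make the mean of the gains of the first N rounds
    plus the discounted value of V where the game is live nonincreasing in N; it
    starts at V x, and the discounted part tends to 0. *)
Lemma J1_le_value x tau1 : stopping_time X xi1 tau1 ->
  (forall y, stop_val p2 f h y <= V y) ->
  (forall y, cont_val Pi alpha p2 g V y <= V y) ->
  (J1 P X alpha f g h x tau1 (markov_time X xi2 p2) <= (V x)%:E)%E.
Proof.
move=> st1 SV CV; have st2 := @stopping_markov_time xi2 p2 mp2.
have [_ lim] := payoff_limit alpha01 T_geom indep mf mg mh f_L1 g_L1 h_L1 st1 st2 x.
rewrite (J1_payoff alpha01 T_geom indep mf mg mh f_L1 g_L1 h_L1 st1 st2) lee_fin.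
have e0 := live_discounted_cvg0 st1 st2 x.
set tau2 := markov_time X xi2 p2 in st2 lim e0 *.
have partial N : \sum_(n < N) \int[P x]_w gain X alpha f g h tau1 tau2 n w +
    alpha ^+ N * \int[P x]_w ((live tau1 tau2 N w)%:R * V (X N w)) <= V x.
  elim: N => [|N IH].
    rewrite big_ord0 expr0 add0r mul1r -[leRHS](start_expectation X_markov x mV).
    rewrite le_eqVlt; apply/orP; left; apply/eqP; apply: eq_Rintegral => w _.
    by rewrite /live; case: (tau1 w) (tau2 w) => [?|] [?|]; rewrite mul1r.
  rewrite big_ord_recr /= -addrA; apply: le_trans IH; rewrite lerD2l.
  rewrite /tau2 markov_timeE (one_step _ X_markov xi2_unif indep)//.
  have /andP[a0 a1] := alpha01.
  apply: ler_wpM2l; first by rewrite exprn_ge0// ltW.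
  have mnb1 n := measurable_not_before n st1.
  have mnb2 n := measurable_not_before n st2.
  have gS := path_L1_stop_val mp2 p2_01 f_path h_path.
  have gC := path_L1_cont_val alpha X_markov indep mp2 p2_01 g_path V_path.
  apply: le_Rintegral => //.
  - apply: L1D; apply: L1_bool; [|exact: gS.2| |exact: gC.2].
    + by apply: measurable_and => //; exact: measurable_time_eq st1.
    + exact: measurable_and.
  - by apply: L1_bool; [exact: (measurable_live st1 st2)|exact: V_path.2].
  move=> w _; rewrite /live time_eqE.
  have SVw := SV (X N w); have CVw := CV (X N w).
  have := @not_beforeS (tau1 w) N.
  case: (not_before (inhomogeneous_time _ _ _ _) _);
    case: (not_before (tau1 w) N.+1); case: (not_before (tau1 w) N) => /= imp;
    rewrite ?(mul0r, mul1r, add0r, addr0)//; by have := imp isT.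
pose e N := alpha ^+ N * \int[P x]_w ((live tau1 tau2 N w)%:R * V (X N w)).
have lim2 : V x - e N @[N --> \oo] --> V x.
  by rewrite -[X in _ --> X]subr0; apply: cvgB => //; exact: cvg_cst.
apply: (ler_cvg_to lim lim2); apply: nearW => N.
by rewrite lerBrDr partial.
Qed.

(** Here the same quantity is constant in N: V is consistent with every round. *)
Lemma J1_eq_value x :
  (forall y, V y = mixed_val Pi alpha f g h (fun=> p1) (fun=> p2) 0%N V y) ->
  J1 P X alpha f g h x (markov_time X xi1 p1) (markov_time X xi2 p2) = (V x)%:E.
Proof.
move=> VE; have st1 := @stopping_markov_time xi1 p1 mp1.
have st2 := @stopping_markov_time xi2 p2 mp2.
have [_ lim] := payoff_limit alpha01 T_geom indep mf mg mh f_L1 g_L1 h_L1 st1 st2 x.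
rewrite (J1_payoff alpha01 T_geom indep mf mg mh f_L1 g_L1 h_L1 st1 st2).
have e0 := live_discounted_cvg0 st1 st2 x; congr EFin.
have partial N := @backward_induction _ _ _ _ _ P Pi X xi1 xi2 T alpha f g h
  X_markov xi1_unif xi2_unif indep f_path g_path h_path (fun=> p1) (fun=> p2)
  (fun=> mp1) (fun=> p1_01) (fun=> mp2) (fun=> p2_01) x N (fun=> V) (fun=> V_path)
  (fun _ _ => funext VE).
have := cvgD lim e0.
rewrite [X in X @ _](_ : _ = fun=> V x); last by apply/funext => N; exact: partial.
rewrite addr0 => limV.
exact: (cvg_unique (@Rhausdorff R) (limV _) (cvg_cst (V x))).
Qed.

End verification.

(** * Values with finite horizon *)

Section value_iteration.
Context {d d' : measure_display} {R : realType}.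
Context {Om : measurableType d} {E : measurableType d'}.
Variables (P : E -> probability Om R) (Pi : R.-pker E ~> E).
Variables (X : nat -> {mfun Om >-> E}) (xi1 xi2 : nat -> {mfun Om >-> R}).
Variables (T : {mfun Om >-> nat}) (alpha : R).
Hypothesis alpha01 : 0 < alpha < 1.
Hypothesis X_markov : markov_process P Pi X.
Hypothesis xi1_unif : forall x n, uniform01 (P x) (xi1 n).
Hypothesis xi2_unif : forall x n, uniform01 (P x) (xi2 n).
Hypothesis T_geom : forall x k,
  P x [set w | T w = k] = ((1 - alpha) * alpha ^+ k)%:E.
Hypothesis indep : forall x, mutual_independence (P x) (source_sigma X xi1 xi2 T).

Variables (p1 p2 : E -> R).
Hypothesis mp1 : measurable_fun setT p1.
Hypothesis mp2 : measurable_fun setT p2.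
Hypothesis p1_01 : forall y, 0 <= p1 y <= 1.
Hypothesis p2_01 : forall y, 0 <= p2 y <= 1.

Definition first_then (a p : E -> R) (n : nat) : E -> R := if n is 0%N then a else p.

(** The expected gains of k rounds under the Markovian times of p1 and p2. *)
Fixpoint value_iter (f g h : E -> R) (k : nat) : E -> R :=
  if k is j.+1 then
    mixed_val Pi alpha f g h (fun=> p1) (fun=> p2) 0%N (value_iter f g h j)
  else fun=> 0.

Section iteration.
Variables (f g h : E -> R).
Hypothesis mf : measurable_fun setT f.
Hypothesis mg : measurable_fun setT g.
Hypothesis mh : measurable_fun setT h.
Hypothesis f_L1 : sup_killed_L1 P X T f.
Hypothesis g_L1 : sup_killed_L1 P X T g.
Hypothesis h_L1 : sup_killed_L1 P X T h.

Let f_path : path_L1 P X f := sup_killed_path_L1 alpha01 T_geom indep mf f_L1.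
Let g_path : path_L1 P X g := sup_killed_path_L1 alpha01 T_geom indep mg g_L1.
Let h_path : path_L1 P X h := sup_killed_path_L1 alpha01 T_geom indep mh h_L1.

Lemma path_L1_mixed_val (a b u : E -> R) :
  measurable_fun setT a -> (forall y, 0 <= a y <= 1) ->
  measurable_fun setT b -> (forall y, 0 <= b y <= 1) ->
  path_L1 P X u ->
  path_L1 P X (mixed_val Pi alpha f g h (fun=> a) (fun=> b) 0%N u).
Proof.
move=> ma a01 mb b01 gu.
rewrite (_ : mixed_val _ _ _ _ _ _ _ _ _ =
    stop_val a (cont_val Pi alpha b g u) (stop_val b f h)).
  apply: path_L1_stop_val => //; first exact: path_L1_cont_val.
  exact: path_L1_stop_val.
by apply/funext => y; rewrite /mixed_val [in RHS]/stop_val addrC.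
Qed.

Lemma path_L1_value_iter k : path_L1 P X (value_iter f g h k).
Proof.
elim: k => [|k IH] /=; last exact: path_L1_mixed_val.
by split=> // x n; exact: finite_measure_integrable_cst.
Qed.

Variables (a b : E -> R).
Hypothesis ma : measurable_fun setT a.
Hypothesis a01 : forall y, 0 <= a y <= 1.
Hypothesis mb : measurable_fun setT b.
Hypothesis b01 : forall y, 0 <= b y <= 1.

Local Notation tau1 := (inhomogeneous_time X xi1 (first_then a p1)).
Local Notation tau2 := (inhomogeneous_time X xi2 (first_then b p2)).

(** When only the first round is played with other probabilities, the gains of k+1
    rounds are worth one such round followed by [value_iter f g h k], and they
    tend to the payoff. *)
Lemma first_step_limit x :
  exists2 l : R, J1 P X alpha f g h x tau1 tau2 = l%:E &
  mixed_val Pi alpha f g h (fun=> a) (fun=> b) 0%N (value_iter f g h k) x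
    @[k --> \oo] --> l.
Proof.
have mfa n : measurable_fun setT (first_then a p1 n) by case: n.
have mfb n : measurable_fun setT (first_then b p2 n) by case: n.
have fa01 n y : 0 <= first_then a p1 n y <= 1 by case: n.
have fb01 n y : 0 <= first_then b p2 n y <= 1 by case: n.
have st1 : stopping_time X xi1 tau1 by exact: stopping_inhomogeneous_time mfa.
have st2 : stopping_time X xi2 tau2 by exact: stopping_inhomogeneous_time mfb.
have [_ lim] := payoff_limit alpha01 T_geom indep mf mg mh f_L1 g_L1 h_L1 st1 st2 x.
exists (\int[P x]_w payoff X alpha f g h tau1 tau2 w).
  exact: (J1_payoff alpha01 T_geom indep mf mg mh f_L1 g_L1 h_L1 st1 st2).
suff partial k : mixed_val Pi alpha f g h (fun=> a) (fun=> b) 0%N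
    (value_iter f g h k) x =
    \sum_(n < k.+1) \int[P x]_w gain X alpha f g h tau1 tau2 n w.
  rewrite [X in X @ _](_ : _ = fun k =>
    \sum_(n < k.+1) \int[P x]_w gain X alpha f g h tau1 tau2 n w).
    by rewrite (cvg_shiftS (fun N =>
      \sum_(n < N) \int[P x]_w gain X alpha f g h tau1 tau2 n w)).
  by apply/funext => k.
(* The values that [backward_induction] needs over k+1 rounds: after n rounds,
   k+1-n remain, and at the end the terminal reward is 0. *)
pose v n := if n is 0%N then
  mixed_val Pi alpha f g h (fun=> a) (fun=> b) 0%N (value_iter f g h k)
  else value_iter f g h (k.+1 - n).
have gv n : path_L1 P X (v n).
  case: n => [|n]; last exact: path_L1_value_iter.
  by apply: path_L1_mixed_val => //; exact: path_L1_value_iter.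
rewrite -[LHS]/(v 0%N x).
rewrite -(@backward_induction _ _ _ _ _ P Pi X xi1 xi2 T alpha f g h
  X_markov xi1_unif xi2_unif indep f_path g_path h_path (first_then a p1)
  (first_then b p2) mfa fa01 mfb fb01 x k.+1 v gv).
  rewrite [X in _ + X](_ : _ = 0) ?addr0// /v subnn /=.
  under eq_Rintegral do rewrite mulr0.
  by rewrite Rintegral_cst// mul0r mulr0.
move=> [|n] nk; first by rewrite /v subSS subn0.
by rewrite /v subSn// subSS.
Qed.

End iteration.

Lemma kernel_op_le (u u' : E -> R) x : path_L1 P X u -> path_L1 P X u' ->
  (forall y, u y <= u' y) -> kernel_op Pi u x <= kernel_op Pi u' x.
Proof.
move=> gu gu' le; apply: le_Rintegral => //; exact: path_L1_kernel X_markov indep _ _ _.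
Qed.

Let alpha0 : 0 <= alpha. Proof. by case/andP: alpha01 => /ltW. Qed.

Lemma mixed_val_le (f g h u u' : E -> R) y : path_L1 P X u -> path_L1 P X u' ->
  (forall z, u z <= u' z) ->
  mixed_val Pi alpha f g h (fun=> p1) (fun=> p2) 0%N u y <=
  mixed_val Pi alpha f g h (fun=> p1) (fun=> p2) 0%N u' y.
Proof.
move=> gu gu' le; have leK := kernel_op_le y gu gu' le.
have /andP[a0 a1] := p1_01 y; have /andP[b0 b1] := p2_01 y.
rewrite /mixed_val /cont_val lerD2l ler_wpM2l ?subr_ge0// lerD2r.
by rewrite ler_wpM2l// mulr_ge0 ?subr_ge0.
Qed.

Section domination.
Variables (f g h : E -> R).
Hypothesis mf : measurable_fun setT f.
Hypothesis mg : measurable_fun setT g.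
Hypothesis mh : measurable_fun setT h.
Hypothesis f_L1 : sup_killed_L1 P X T f.
Hypothesis g_L1 : sup_killed_L1 P X T g.
Hypothesis h_L1 : sup_killed_L1 P X T h.

Let nf (y : E) : R := `|f y|.
Let ng (y : E) : R := `|g y|.
Let nh (y : E) : R := `|h y|.
Let mnf : measurable_fun setT nf. Proof. exact: measurableT_comp. Qed.
Let mng : measurable_fun setT ng. Proof. exact: measurableT_comp. Qed.
Let mnh : measurable_fun setT nh. Proof. exact: measurableT_comp. Qed.
Let nf_L1 : sup_killed_L1 P X T nf.
Proof. by apply: sup_killed_L1_norm f_L1 => y; rewrite normr_id. Qed.
Let ng_L1 : sup_killed_L1 P X T ng.
Proof. by apply: sup_killed_L1_norm g_L1 => y; rewrite normr_id. Qed.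
Let nh_L1 : sup_killed_L1 P X T nh.
Proof. by apply: sup_killed_L1_norm h_L1 => y; rewrite normr_id. Qed.

Local Notation v := (value_iter f g h).
Local Notation nv := (value_iter nf ng nh).

Let v_path k : path_L1 P X (v k).
Proof. exact: path_L1_value_iter. Qed.
Let nv_path k : path_L1 P X (nv k).
Proof. exact: path_L1_value_iter. Qed.

Lemma mixed_val_norm (u u' : E -> R) y : path_L1 P X u -> path_L1 P X u' ->
  (forall z, `|u z| <= u' z) ->
  `|mixed_val Pi alpha f g h (fun=> p1) (fun=> p2) 0%N u y| <=
  mixed_val Pi alpha nf ng nh (fun=> p1) (fun=> p2) 0%N u' y.
Proof.
move=> gu gu' le.
have leK : `|kernel_op Pi u y| <= kernel_op Pi u' y.
  apply: le_trans (le_normr_Rintegral measurableT (path_L1_kernel X_markov indep gu y)) _.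
  by apply: kernel_op_le => //; exact: path_L1_norm.
have /andP[a0 a1] := p1_01 y; have /andP[b0 b1] := p2_01 y.
have a1' : 0 <= 1 - p1 y by rewrite subr_ge0.
have b1' : 0 <= 1 - p2 y by rewrite subr_ge0.
rewrite /mixed_val /stop_val /cont_val.
apply: le_trans (ler_normD _ _) _; apply: lerD; rewrite normrM ger0_norm//;
  apply: ler_wpM2l => //; apply: le_trans (ler_normD _ _) _; apply: lerD;
  rewrite normrM ger0_norm// ?mulr_ge0// ler_wpM2l// mulr_ge0//.
Qed.

Lemma value_iter_norm k y : `|v k y| <= nv k y.
Proof.
elim: k y => [|k IH] y; first by rewrite /= normr0.
exact: mixed_val_norm.
Qed.

Let nv_ge0 k y : 0 <= nv k y.
Proof. exact: le_trans (value_iter_norm k y). Qed.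

Let nv_nondecreasing y : nondecreasing_seq (fun k => (nv k y)%:E).
Proof.
apply/nondecreasing_seqP => k; rewrite lee_fin.
elim: k y => [|k IH] y; first exact: nv_ge0.
exact: (mixed_val_le nf ng nh y (nv_path k) (nv_path k.+1) IH).
Qed.

(** The values [nv k] of the game with |f|, |g| and |h| dominate |v k| and increase to
    a limit w. If nobody stops in the first round, [nv k] enters the payoff only
    through alpha * Pi (nv k) x, which thus converges to a finite limit; by monotone
    convergence w is integrable, and dominated convergence applies to v. *)
Lemma value_iter_kernel_limit (V : E -> R) x : measurable_fun setT V ->
  (forall y, v k y @[k --> \oo] --> V y) ->
  (Pi x).-integrable setT (EFin \o V) /\
  kernel_op Pi (v k) x @[k --> \oo] --> kernel_op Pi V x.
Proof.
move=> mV VE.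
have c01 (y : E) : 0 <= (cst 0 : E -> R) y <= 1 by rewrite lexx ler01.
have mc : measurable_fun setT (cst 0 : E -> R) by [].
have [l _] := first_step_limit mnf mng mnh nf_L1 ng_L1 nh_L1 mc c01 mc c01 x.
rewrite [X in X @ _](_ : _ = fun k => alpha * kernel_op Pi (nv k) x); last first.
  by apply/funext => k; rewrite /mixed_val /cont_val /=; ring.
move=> lim.
pose w y := ereal_sup (range (fun k => (nv k y)%:E)).
have wlim y : (nv k y)%:E @[k --> \oo] --> w y.
  exact: ereal_nondecreasing_cvgn.
have mnv k : measurable_fun setT (fun y => (nv k y)%:E).
  by apply/measurable_EFinP; exact: (nv_path k).1.
have mw : measurable_fun setT w.
  by apply: (emeasurable_fun_cvg (fun k y => (nv k y)%:E)).
have w0 y : (0 <= w y)%E.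
  by apply: le_trans (ereal_sup_ubound (ex_intro2 _ _ 0%N I erefl)).
have iw : (Pi x).-integrable setT w.
  apply/integrableP; split => //.
  under eq_integral do rewrite gee0_abs//.
  have : (kernel_op Pi (nv k) x)%:E @[k --> \oo] --> (\int[Pi x]_y w y)%E.
    rewrite [X in X @ _](_ : _ = fun k => (\int[Pi x]_y (nv k y)%:E)%E); last first.
      by apply/funext => k; rewrite (ge0_kernel_op X_markov indep).
    have -> : (\int[Pi x]_y w y = \int[Pi x]_y limn (fun k => (nv k y)%:E))%E.
      by apply: eq_integral => y _; apply/esym/cvg_lim.
    apply: cvg_monotone_convergence => //; first by move=> k y _; rewrite lee_fin.
  have limK : (kernel_op Pi (nv k) x)%:E @[k --> \oo] --> (alpha^-1 * l)%:E.
    apply: cvg_EFin; first exact: nearW.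
    have /andP[a0 _] := alpha01.
    rewrite [X in X @ _](_ : _ = fun k => alpha^-1 * (alpha * kernel_op Pi (nv k) x)).
      exact: cvgMr.
    by apply/funext => k /=; rewrite mulKf// gt_eqF.
  by move=> /(cvg_unique (@ereal_hausdorff R) limK) <-; rewrite ltry.
have [] := @dominated_convergence _ _ _ (Pi x) setT measurableT
  (fun k y => (v k y)%:E) (EFin \o V) w.
- by move=> k; apply/measurable_EFinP; exact: (v_path k).1.
- exact/measurable_EFinP.
- by apply: aeW => y _; apply: cvg_EFin; [exact: nearW|exact: VE].
- exact: iw.
- apply: aeW => y k _ /=; apply: (@le_trans _ _ (nv k y)%:E).
    by rewrite lee_fin value_iter_norm.
  exact: ereal_sup_ubound.
move=> iV _ cv; split=> //; apply: fine_cvg.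
by rewrite /kernel_op /Rintegral fineK//; exact: integrable_fin_num.
Qed.

End domination.
End value_iteration.

(** * Exchanging the players *)

Section players.
Context {d d' : measure_display} {R : realType}.
Context {Om : measurableType d} {E : measurableType d'}.
Variables (P : E -> probability Om R) (Pi : R.-pker E ~> E).
Variables (X : nat -> {mfun Om >-> E}).
Variables (T : {mfun Om >-> nat}) (alpha : R).
Hypothesis alpha01 : 0 < alpha < 1.
Hypothesis X_markov : markov_process P Pi X.
Hypothesis T_geom : forall x k,
  P x [set w | T w = k] = ((1 - alpha) * alpha ^+ k)%:E.

Definition swap_noise (s : source) : source :=
  match s with
  | Noise1 n => Noise2 n
  | Noise2 n => Noise1 n
  | s => s
  end.

Lemma independence_swap (Q : probability Om R) (xi1 xi2 : nat -> {mfun Om >-> R}) :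
  mutual_independence Q (source_sigma X xi1 xi2 T) ->
  mutual_independence Q (source_sigma X xi2 xi1 T).
Proof.
move=> indep n j A j_inj jA; apply: (indep n (swap_noise \o j)).
  by apply: inj_comp j_inj; apply: (can_inj (g := swap_noise)); case.
by move=> k /=; have := jA k; case: (j k).
Qed.

Variables (xi1 xi2 : nat -> {mfun Om >-> R}).
Hypothesis xi1_unif : forall x n, uniform01 (P x) (xi1 n).
Hypothesis indep : forall x, mutual_independence (P x) (source_sigma X xi1 xi2 T).

Lemma opp_sup_killed (u : E -> R) :
  sup_killed_L1 P X T u -> sup_killed_L1 P X T (fun y => - u y).
Proof. by apply: sup_killed_L1_norm => y; rewrite normrN. Qed.

Variables (f g h : E -> R).
Hypothesis mf : measurable_fun setT f.
Hypothesis mg : measurable_fun setT g.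
Hypothesis mh : measurable_fun setT h.
Hypothesis f_L1 : sup_killed_L1 P X T f.
Hypothesis g_L1 : sup_killed_L1 P X T g.
Hypothesis h_L1 : sup_killed_L1 P X T h.

Lemma payoff_swap tau1 tau2 w :
  payoff X alpha (fun y => - g y) (fun y => - f y) (fun y => - h y) tau2 tau1 w =
  -1 * payoff X alpha f g h tau1 tau2 w.
Proof.
rewrite /payoff [tau2 w == _]eq_sym /discounted.
case: (eqVneq (tau1 w) (tau2 w)) => [->|_] /=;
  case: (tau2 w) => [n|] /=; case: (tau1 w) => [m|] /=; ring.
Qed.

(** Player 2 minimizes what player 1 receives, hence maximizes its opposite, in which
    the roles of f and g are exchanged. *)
Lemma J1_swap tau1 tau2 x : stopping_time X xi1 tau1 -> stopping_time X xi2 tau2 ->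
  J1 P X alpha (fun y => - g y) (fun y => - f y) (fun y => - h y) x tau2 tau1 =
  (- J1 P X alpha f g h x tau1 tau2)%E.
Proof.
move=> st1 st2.
have mN (u : E -> R) : measurable_fun setT u -> measurable_fun setT (fun y => - u y).
  by move=> mu; exact: measurableT_comp.
rewrite (J1_payoff alpha01 T_geom indep mf mg mh f_L1 g_L1 h_L1 st1 st2).
rewrite (J1_payoff alpha01 T_geom (fun x => independence_swap (indep x))
  (mN _ mg) (mN _ mf) (mN _ mh) (opp_sup_killed g_L1) (opp_sup_killed f_L1)
  (opp_sup_killed h_L1) st2 st1).
have [iL _] := payoff_limit alpha01 T_geom indep mf mg mh f_L1 g_L1 h_L1 st1 st2 x.
under eq_Rintegral do rewrite payoff_swap.
by rewrite RintegralZl// mulN1r.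
Qed.

Variables (V p1 : E -> R).
Hypothesis mV : measurable_fun setT V.
Hypothesis V_L1 : sup_killed_L1 P X T V.
Hypothesis mp1 : measurable_fun setT p1.
Hypothesis p1_01 : forall y, 0 <= p1 y <= 1.

Lemma value_le_J1 x tau2 : stopping_time X xi2 tau2 ->
  (forall y, V y <= stop_val p1 g h y) ->
  (forall y, V y <= cont_val Pi alpha p1 f V y) ->
  ((V x)%:E <= J1 P X alpha f g h x (markov_time X xi1 p1) tau2)%E.
Proof.
move=> st2 VS VC; have st1 := @stopping_markov_time _ _ _ _ _ X xi1 p1 mp1.
have mN (u : E -> R) : measurable_fun setT u -> measurable_fun setT (fun y => - u y).
  by move=> mu; exact: measurableT_comp.
have V_path := sup_killed_path_L1 alpha01 T_geom indep mV V_L1.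
have kN y : kernel_op Pi (fun z => - V z) y = - kernel_op Pi V y.
  rewrite /kernel_op; under eq_Rintegral do rewrite -mulN1r.
  by rewrite RintegralZl ?mulN1r//; exact: (path_L1_kernel X_markov indep V_path).
rewrite -[leRHS]oppeK -J1_swap// leeNr -EFinN.
apply: (@J1_le_value _ _ _ _ _ P Pi X xi2 xi1 T alpha _ _ _ alpha01 (mN _ mg) (mN _ mf)
  (mN _ mh) X_markov xi1_unif T_geom (fun x => independence_swap (indep x))
  (opp_sup_killed g_L1) (opp_sup_killed f_L1) (opp_sup_killed h_L1)
  (fun y => - V y) (mN _ mV) (opp_sup_killed V_L1)) => // y.
  by have := VS y; rewrite /stop_val; lra.
by have := VC y; rewrite /cont_val kN; lra.
Qed.

End players.

(** * Mixtures that attain an extremum *)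

(** If a mixture of two numbers that are at most v equals v, then each of the two that
    has positive weight equals v. *)
Lemma max_mixture (R : realDomainType) (p S C v : R) : 0 <= p <= 1 ->
  S <= v -> C <= v -> v = p * S + (1 - p) * C ->
  [/\ v = Num.max C S, 0 < p -> C <= S & p < 1 -> S <= C].
Proof.
move=> /andP[p0 p1] Sv Cv vE.
have S1 : 0 < p -> S = v.
  move=> p_gt0; apply/le_anti; rewrite Sv /= -subr_ge0.
  by rewrite -(pmulr_rge0 _ p_gt0); nra.
have C1 : p < 1 -> C = v.
  move=> p_lt1; apply/le_anti; rewrite Cv /= -subr_ge0.
  by rewrite -(@pmulr_rge0 _ (1 - p)) ?subr_gt0//; nra.
split=> [|/S1->//|/C1->//].
have [/S1 Sv'|] := ltrP 0 p; first by rewrite Sv' max_r.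
move=> p_le0; rewrite C1 ?max_l//; exact: le_lt_trans p_le0 ltr01.
Qed.

Lemma min_mixture (R : realDomainType) (p S C v : R) : 0 <= p <= 1 ->
  v <= S -> v <= C -> v = p * S + (1 - p) * C ->
  [/\ v = Num.min C S, 0 < p -> S <= C & p < 1 -> C <= S].
Proof.
move=> p01 vS vC vE.
have [] := @max_mixture _ p (- S) (- C) (- v) p01; rewrite ?lerN2//.
  by rewrite {1}vE; ring.
rewrite -oppr_min => /oppr_inj vmin SC CS.
by split=> // [/SC|/CS]; rewrite lerN2.
Qed.

Lemma mixture_max (R : realDomainType) (p S C v : R) : 0 <= p <= 1 ->
  v = Num.max C S -> (0 < p -> C <= S) -> (p < 1 -> S <= C) ->
  v = p * S + (1 - p) * C.
Proof.
move=> /andP[p0 p1] -> pS pC.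
have [p_gt0|p_le0] := ltrP 0 p; last first.
  have {}p0 : p = 0 by apply/le_anti/andP.
  by rewrite p0 max_l ?pC ?p0// subr0 mul0r add0r mul1r.
rewrite max_r ?pS//.
have [p_lt1|p_ge1] := ltrP p 1; last first.
  by have -> : p = 1; [apply/le_anti/andP|rewrite subrr mul1r mul0r addr0].
have -> : C = S by apply/le_anti; rewrite pS ?pC.
by ring.
Qed.

(** * Deviations in the first round *)

Section deviations.
Context {d d' : measure_display} {R : realType}.
Context {Om : measurableType d} {E : measurableType d'}.
Variables (P : E -> probability Om R) (Pi : R.-pker E ~> E).
Variables (X : nat -> {mfun Om >-> E}) (xi1 xi2 : nat -> {mfun Om >-> R}).
Variables (T : {mfun Om >-> nat}) (alpha : R) (f g h : E -> R).
Hypothesis alpha01 : 0 < alpha < 1.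
Hypothesis mf : measurable_fun setT f.
Hypothesis mg : measurable_fun setT g.
Hypothesis mh : measurable_fun setT h.
Hypothesis X_markov : markov_process P Pi X.
Hypothesis xi1_unif : forall x n, uniform01 (P x) (xi1 n).
Hypothesis xi2_unif : forall x n, uniform01 (P x) (xi2 n).
Hypothesis T_geom : forall x k,
  P x [set w | T w = k] = ((1 - alpha) * alpha ^+ k)%:E.
Hypothesis indep : forall x, mutual_independence (P x) (source_sigma X xi1 xi2 T).
Hypothesis f_L1 : sup_killed_L1 P X T f.
Hypothesis g_L1 : sup_killed_L1 P X T g.
Hypothesis h_L1 : sup_killed_L1 P X T h.
Variables (p1 p2 V : E -> R).
Hypothesis mp1 : measurable_fun setT p1.
Hypothesis mp2 : measurable_fun setT p2.
Hypothesis mV : measurable_fun setT V.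
Hypothesis p1_01 : forall y, 0 <= p1 y <= 1.
Hypothesis p2_01 : forall y, 0 <= p2 y <= 1.
Hypothesis V_value : equilibrium_value P X xi1 xi2 alpha f g h p1 p2 V.

Local Notation v := (value_iter Pi alpha p1 p2 f g h).

Lemma first_then_same (p : E -> R) : first_then p p = fun=> p.
Proof. by apply/funext => -[]. Qed.

(** The case of [first_step_limit] without deviation. *)
Lemma value_iter_cvg y : v k y @[k --> \oo] --> V y.
Proof.
have [l] := first_step_limit alpha01 X_markov xi1_unif xi2_unif T_geom indep
  mp1 mp2 p1_01 p2_01 mf mg mh f_L1 g_L1 h_L1 mp1 p1_01 mp2 p2_01 y.
rewrite !first_then_same -!markov_timeE -V_value => -[<-].
by rewrite -(cvg_shiftS (fun k => v k y)).
Qed.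

Lemma value_kernel_integrable x : (Pi x).-integrable setT (EFin \o V).
Proof.
exact: (value_iter_kernel_limit alpha01 X_markov xi1_unif xi2_unif T_geom indep
  mp1 mp2 p1_01 p2_01 mf mg mh f_L1 g_L1 h_L1 x mV value_iter_cvg).1.
Qed.

(** V is paid after the first round: the limit in [first_step_limit] can be taken
    inside, since [mixed_val] depends on its last function only through
    [kernel_op]. *)
Lemma J1_first_then (a b : E -> R) x :
  measurable_fun setT a -> (forall y, 0 <= a y <= 1) ->
  measurable_fun setT b -> (forall y, 0 <= b y <= 1) ->
  J1 P X alpha f g h x (inhomogeneous_time X xi1 (first_then a p1))
    (inhomogeneous_time X xi2 (first_then b p2)) =
  (mixed_val Pi alpha f g h (fun=> a) (fun=> b) 0%N V x)%:E.
Proof.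
move=> ma a01 mb b01.
have [l -> lim] := first_step_limit alpha01 X_markov xi1_unif xi2_unif T_geom indep
  mp1 mp2 p1_01 p2_01 mf mg mh f_L1 g_L1 h_L1 ma a01 mb b01 x.
have [_ limK] := value_iter_kernel_limit alpha01 X_markov xi1_unif xi2_unif T_geom indep
  mp1 mp2 p1_01 p2_01 mf mg mh f_L1 g_L1 h_L1 x mV value_iter_cvg.
congr EFin; apply: (cvg_unique (@Rhausdorff R) lim).
rewrite /mixed_val /cont_val; apply: cvgD; first exact: cvg_cst.
apply: cvgMr; apply: cvgD; last exact: cvg_cst.
exact: cvgMr.
Qed.

Lemma value_mixed x : V x = mixed_val Pi alpha f g h (fun=> p1) (fun=> p2) 0%N V x.
Proof.
have := J1_first_then x mp1 p1_01 mp2 p2_01.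
by rewrite !first_then_same -!markov_timeE -V_value => -[].
Qed.

Hypothesis equil : global_equilibrium P X xi1 xi2 alpha f g h p1 p2.

Let stopping_first_then (xi : nat -> {mfun Om >-> R}) (a p : E -> R) :
  measurable_fun setT a -> measurable_fun setT p ->
  stopping_time X xi (inhomogeneous_time X xi (first_then a p)).
Proof. by move=> ma mp; apply: stopping_inhomogeneous_time; case. Qed.

Lemma deviation1 (a : E -> R) x :
  measurable_fun setT a -> (forall y, 0 <= a y <= 1) ->
  mixed_val Pi alpha f g h (fun=> a) (fun=> p2) 0%N V x <= V x.
Proof.
move=> ma a01; rewrite -lee_fin -J1_first_then// first_then_same -markov_timeE.
have [+ _] := equil x; rewrite -V_value => <-.
by apply: ereal_sup_ubound; eexists; [exact: (stopping_first_then ma mp1)|].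
Qed.

Lemma deviation2 (b : E -> R) x :
  measurable_fun setT b -> (forall y, 0 <= b y <= 1) ->
  V x <= mixed_val Pi alpha f g h (fun=> p1) (fun=> b) 0%N V x.
Proof.
move=> mb b01; rewrite -lee_fin -J1_first_then// first_then_same -markov_timeE.
have [_] := equil x; rewrite -V_value => ->.
by apply: ereal_inf_lbound; eexists; [exact: (stopping_first_then mb mp2)|].
Qed.

(** Stopping probabilities 1 and 0 in the first round turn the mixed value into the
    stopping and the continuation rate. *)
Lemma equilibrium_satisfies_system : equilibrium_system Pi alpha f g h p1 p2 V.
Proof.
move=> x C1 S1 C2 S2.
have m0 : measurable_fun [set: E] (fun=> 0 : R) by [].
have m1 : measurable_fun [set: E] (fun=> 1 : R) by [].
have c0 (y : E) : 0 <= (0 : R) <= 1 by rewrite lexx ler01.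
have c1 (y : E) : 0 <= (1 : R) <= 1 by rewrite lexx ler01.
have SV1 : S1 <= V x.
  by have := deviation1 x m1 c1; rewrite /mixed_val mul1r subrr mul0r addr0.
have CV1 : C1 <= V x.
  by have := deviation1 x m0 c0; rewrite /mixed_val mul0r subr0 mul1r add0r.
have VS2 : V x <= S2.
  have := deviation2 x m1 c1; congr (_ <= _).
  by rewrite /S2 /mixed_val /stop_val /cont_val; ring.
have VC2 : V x <= C2.
  have := deviation2 x m0 c0; congr (_ <= _).
  by rewrite /C2 /mixed_val /stop_val /cont_val; ring.
have [maxV stop1 cont1] := max_mixture (p1_01 x) SV1 CV1 (value_mixed x).
have VE2 : V x = p2 x * S2 + (1 - p2 x) * C2.
  by rewrite {1}value_mixed /S2 /C2 /mixed_val /stop_val /cont_val; ring.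
by have [minV stop2 cont2] := min_mixture (p2_01 x) VS2 VC2 VE2.
Qed.

End deviations.

Theorem corollary5p1 (R : realType) (d d' : measure_display)
    (E : measurableType d) (Om : measurableType d')
    (P : E -> probability Om R) (Pi : R.-pker E ~> E)
    (X : nat -> {mfun Om >-> E}) (xi1 xi2 : nat -> {mfun Om >-> R})
    (T : {mfun Om >-> nat}) (alpha : R) (f g h : E -> R)
    (alpha01 : 0 < alpha < 1)
    (mf : measurable_fun [set: E] f) (mg : measurable_fun [set: E] g)
    (mh : measurable_fun [set: E] h)
    (X_markov : markov_process P Pi X)
    (xi1_unif : forall x n, uniform01 (P x) (xi1 n))
    (xi2_unif : forall x n, uniform01 (P x) (xi2 n))
    (T_geom : forall x k,
       P x [set w | T w = k] = ((1 - alpha) * alpha ^+ k)%:E)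
    (indep : forall x, mutual_independence (P x) (source_sigma X xi1 xi2 T))
    (f_L1 : sup_killed_L1 P X T f) (g_L1 : sup_killed_L1 P X T g)
    (h_L1 : sup_killed_L1 P X T h)
    (p1 p2 V : E -> R)
    (mp1 : measurable_fun [set: E] p1) (mp2 : measurable_fun [set: E] p2)
    (mV : measurable_fun [set: E] V)
    (p1_01 : forall x, 0 <= p1 x <= 1) (p2_01 : forall x, 0 <= p2 x <= 1) :
  (global_equilibrium P X xi1 xi2 alpha f g h p1 p2 ->
   equilibrium_value P X xi1 xi2 alpha f g h p1 p2 V ->
   (forall x, (Pi x).-integrable [set: E] (EFin \o V)) /\
   equilibrium_system Pi alpha f g h p1 p2 V) /\
  (equilibrium_system Pi alpha f g h p1 p2 V ->
   sup_killed_L1 P X T V ->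
   global_equilibrium P X xi1 xi2 alpha f g h p1 p2 /\
   equilibrium_value P X xi1 xi2 alpha f g h p1 p2 V).
Proof.
split=> [equil V_value|system V_L1].
  split=> [x|]; first exact: (value_kernel_integrable alpha01 mf mg mh X_markov
    xi1_unif xi2_unif T_geom indep f_L1 g_L1 h_L1 mp1 mp2 mV p1_01 p2_01 V_value).
  exact: (equilibrium_satisfies_system alpha01 mf mg mh X_markov
    xi1_unif xi2_unif T_geom indep f_L1 g_L1 h_L1 mp1 mp2 mV p1_01 p2_01 V_value equil).
have st1 := @stopping_markov_time _ _ _ _ _ X xi1 p1 mp1.
have st2 := @stopping_markov_time _ _ _ _ _ X xi2 p2 mp2.
have SV y : stop_val p2 f h y <= V y.
  by have [[-> _] _] := system y; rewrite le_max lexx orbT.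
have CV y : cont_val Pi alpha p2 g V y <= V y.
  by have [[{2}-> _] _] := system y; rewrite le_max lexx.
have VS y : V y <= stop_val p1 g h y.
  by have [[_ ->] _] := system y; rewrite ge_min lexx orbT.
have VC y : V y <= cont_val Pi alpha p1 f V y.
  by have [[_ {1}->] _] := system y; rewrite ge_min lexx.
have VE y : V y = mixed_val Pi alpha f g h (fun=> p1) (fun=> p2) 0%N V y.
  by have [[VM _] [c d0 _ _]] := system y; exact: mixture_max.
have JV x : J1 P X alpha f g h x (markov_time X xi1 p1) (markov_time X xi2 p2) = (V x)%:E.
  exact: (J1_eq_value alpha01 mf mg mh X_markov xi1_unif xi2_unif T_geom indep
    f_L1 g_L1 h_L1 mV V_L1 mp1 mp2 p1_01 p2_01).
split=> [J tau1 tau2 x|x]; last by rewrite JV.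
rewrite /J JV; split; apply/eqP; rewrite eq_le; apply/andP; split.
- apply: ge_ereal_sup => _ [t1 st <-].
  exact: (J1_le_value alpha01 mf mg mh X_markov xi2_unif T_geom indep
    f_L1 g_L1 h_L1 mV V_L1 mp2 p2_01).
- by apply: ereal_sup_ubound; exists tau1 => //; exact: JV.
- apply: le_ereal_inf_tmp => _ [t2 st <-].
  exact: (value_le_J1 alpha01 X_markov T_geom xi1_unif indep mf mg mh
    f_L1 g_L1 h_L1 mV V_L1 mp1 p1_01).
- by apply: ereal_inf_lbound; exists tau2 => //; exact: JV.
Qed.
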